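(* Let $D$ be a bounded domain in $\mathbb{C}$, let $S\subset D$ be a closed disc, and let $K\subset\partial D$ be a compact polar set. Then $$\omega(z,S,D)=\inf\{\omega(z,S,D\cup U):U\text{ open},\ K\subset U\},\qquad z\in D.$$ Moreover, if $z\in K$ is a regular boundary point of $D$ (for the Dirichlet problem), then $\inf\{\omega(z,S,D\cup U):U\text{ open},\ K\subset U\}=0$.
   Context: For an open set $\Omega\subset\mathbb{C}$ and $E\subset\Omega$, $\omega(z,E,\Omega)=-\sup\{v(z): v \text{ subharmonic on }\Omega,\ v\le-1\text{ on }E,\ v\le0\text{ on }\Omega\}$, $z\in\Omega$ (for disconnected $\Omega$, computed on each connected component). *)

(* Defs.v *)
From HB Require Import structures.
From mathcomp Require Import all_boot all_order all_algebra.
From mathcomp Require Import all_classical all_reals all_analysis.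
Set Implicit Arguments. Unset Strict Implicit. Unset Printing Implicit Defensive.
Import Order.TTheory GRing.Theory Num.Theory.
Import numFieldNormedType.Exports.
Local Open Scope classical_set_scope.
Local Open Scope ring_scope.

Section Defs.
Variable R : realType.
Notation C := (R * R)%type.

Definition cdist (z w : C) : R :=
  Num.sqrt ((z.1 - w.1) ^+ 2 + (z.2 - w.2) ^+ 2).

Definition circ (z : C) (r t : R) : C := (z.1 + r * cos t, z.2 + r * sin t).

Definition closed_disc (a : C) (r : R) : set C := [set w | cdist a w <= r].

Definition loge (x : R) : \bar R := if x == 0 then -oo%E else (ln x)%:E.

(* Subharmonic function on an open set U (Ransford, Def. 2.2.1):
   u : U -> [-oo, +oo) upper semicontinuous satisfying the local
   submean inequality. (Functions identically -oo are allowed, as in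
   Ransford.) *)
Definition subharmonic (U : set C) (u : C -> \bar R) : Prop :=
  [/\ (forall z, U z -> (u z < +oo)%E),
      (forall z, U z -> forall c : R, (u z < c%:E)%E ->
          \forall w \near z, (u w < c%:E)%E) &
      (forall z, U z -> exists2 rho : R, 0 < rho &
          (forall w, cdist z w < rho -> U w) /\
          (forall r, 0 <= r -> r < rho ->
             (u z <= ((2 * pi)^-1)%R%:E *
                 \int[lebesgue_measure]_(t in `[0%R, (2 * pi)%R]) u (circ z r t))%E))].

Definition harm_measure (z : C) (E Omega : set C) : \bar R :=
  (- ereal_sup [set v z | v in
      [set v | subharmonic Omega v /\
               (forall w, Omega w -> E w -> (v w <= (-1)%:E)%E) /\
               (forall w, Omega w -> (v w <= 0)%E)]])%E.

Definition bounded_domain (D : set C) : Prop :=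
  [/\ open D, connected D, D !=set0 &
      exists M : R, forall z, D z -> `|z.1| <= M /\ `|z.2| <= M].

Definition boundary (D : set C) : set C := closure D `\` D.

Definition energy (mu : {measure set C -> \bar R}) : \bar R :=
  (\int[mu]_z (\int[mu]_w loge (cdist z w)))%E.

(* Polar set (Ransford, Def. 3.2.2): I(mu) = -oo for every finite Borel
   measure mu <> 0 whose support is a compact subset of E. *)
Definition polar (E : set C) : Prop :=
  forall mu : {measure set C -> \bar R},
    (mu setT < +oo)%E -> mu setT != 0%E ->
    (exists2 K : set C, compact K /\ K `<=` E & mu (~` K) = 0%E) ->
    energy mu = -oo%E.

(* Regular boundary point (Ransford, Def. 4.1.4): a barrier exists. *)
Definition regular_point (D : set C) (zeta : C) : Prop :=
  exists N : set C, exists b : C -> \bar R,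
    [/\ open N, N zeta, subharmonic (D `&` N) b,
        (forall z, D z -> N z -> (b z < 0)%E) &
        (forall eps : R, 0 < eps -> exists2 delta : R, 0 < delta &
           forall z, D z -> N z -> cdist z zeta < delta ->
             ((- eps)%:E < b z)%E)].

End Defs.

(* Main.v *)
Require Import Defs.
Set Implicit Arguments. Unset Strict Implicit. Unset Printing Implicit Defensive.
From HB Require Import structures.
From mathcomp Require Import all_boot all_order all_algebra.
From mathcomp Require Import all_classical all_reals all_analysis.
From mathcomp Require Import measurable_realfun.
From mathcomp Require Import zify ring lra.
Import Order.TTheory GRing.Theory Num.Theory.
Import numFieldNormedType.Exports.
Local Open Scope classical_set_scope.
Local Open Scope ring_scope.

(** One inequality is monotonicity: a competitor on $D\cup U$ restricts to a competitor on $D$. For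
    the converse, a competitor $v$ on $D$ has to be continued across $K$ at arbitrarily small cost.
    Polarity makes this possible through [polar_poly]: for every $M$ there are points
    $q_1,\dots,q_n\in K$ with $\prod_i|w-q_i|<e^{-Mn}$ on $K$. If $d$ bounds the distances between
    $D$ and $K$, then $(\delta/n)\sum_i\log|w-q_i|-\delta\log d$ is harmonic and $\le0$ on $D$,
    almost $0$ away from $K$ when $\delta$ is small, and $\le-1$ near $K$ when $M$ is large. Adding
    it to $v$ and taking the maximum with $-1$ gives a function that equals $-1$ on $D$ near $K$,
    and so continues by $-1$ to a neighbourhood of $K$ ([extend_competitor]).

    [polar_poly] is proved by contradiction. If it fails, a greedy choice gives points $w_n\in K$
    with $\prod_{i<n}|w_n-w_i|\ge e^{-Mn}$, and their empirical measures have bounded truncated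
    energies ([greedy_energy]). A limit of these measures is a probability measure on $K$ of energy
    above $-\infty$, against polarity ([no_greedy_sequence]). The limit is built by hand: points of
    $K$ receive infinite binary codes, the frequencies of all prefixes converge along an
    ultrafilter, the limit weights become lengths of nested subintervals of $[0,1)$, and the measure
    is the image of Lebesgue measure under a decoding map.

    At a regular point $\zeta\in K$ the infimum is $\ge0$ because competitors are $\le0$. For the
    upper bound, [bouligand] turns the local barrier into a competitor on all of $D$ that is close
    to $0$ near $\zeta$. After continuation across $K$ nothing is known at $\zeta$ itself, but some
    small circle about $\zeta$ misses $K$ ([polar_radius]), and the continued function is still
    $\ge-\varepsilon$ near this circle. Replacing it inside the circle by its maximum with
    $-\varepsilon$ keeps it a competitor and makes it $\ge-\varepsilon$ at $\zeta$
    ([competitor_at_regular]). *)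

Section Plane.
Variable R : realType.
Notation C := (R * R)%type.
Implicit Types (z w q : C) (r t : R).

(** * Euclidean distance, its topology, and polar coordinates *)

Lemma cdist_ge0 z w : 0 <= cdist z w.
Proof. exact: sqrtr_ge0. Qed.

Lemma cdistC z w : cdist z w = cdist w z.
Proof. by rewrite /cdist; congr Num.sqrt; ring. Qed.

Lemma cdist_sq z w : cdist z w ^+ 2 = (z.1 - w.1) ^+ 2 + (z.2 - w.2) ^+ 2.
Proof. by rewrite sqr_sqrtr // addr_ge0 // sqr_ge0. Qed.

Lemma cdist_fst z w : `|z.1 - w.1| <= cdist z w.
Proof.
by rewrite -sqrtr_sqr ler_sqrt ?lerDl ?sqr_ge0 // addr_ge0 // sqr_ge0.
Qed.

Lemma cdist_snd z w : `|z.2 - w.2| <= cdist z w.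
Proof.
by rewrite -sqrtr_sqr ler_sqrt ?lerDr ?sqr_ge0 // addr_ge0 // sqr_ge0.
Qed.

Lemma cdist_le z w (e : R) : 0 <= e ->
  `|z.1 - w.1| <= e -> `|z.2 - w.2| <= e -> cdist z w <= 2 * e.
Proof.
move=> e0 h1 h2; rewrite -(@ler_pXn2r _ 2) ?nnegrE ?cdist_ge0 ?mulr_ge0 //.
rewrite cdist_sq -(real_normK (num_real (z.1 - w.1))).
rewrite -(real_normK (num_real (z.2 - w.2))).
have := normr_ge0 (z.1 - w.1); have := normr_ge0 (z.2 - w.2); nra.
Qed.

Lemma cdist_triangle z w q : cdist z q <= cdist z w + cdist w q.
Proof.
rewrite -(@ler_pXn2r _ 2) ?nnegrE ?cdist_ge0 ?addr_ge0 ?cdist_ge0 //.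
rewrite sqrrD !cdist_sq.
(* Cauchy-Schwarz; the square handed to [nra] is the defect in Lagrange's identity. *)
have H : (z.1 - w.1) * (w.1 - q.1) + (z.2 - w.2) * (w.2 - q.2)
    <= cdist z w * cdist w q.
  apply: (le_trans (ler_norm _)).
  rewrite -(@ler_pXn2r _ 2) ?nnegrE ?mulr_ge0 ?cdist_ge0 //.
  rewrite exprMn !cdist_sq real_normK ?num_real //.
  have := sqr_ge0 ((z.1 - w.1) * (w.2 - q.2) - (z.2 - w.2) * (w.1 - q.1)); nra.
lra.
Qed.

Lemma cdist0 z : cdist z z = 0.
Proof. by rewrite /cdist !subrr expr0n /= addr0 sqrtr0. Qed.

Lemma cdist_eq0 z w : cdist z w = 0 -> z = w.
Proof.
move=> h; have := cdist_fst z w; have := cdist_snd z w; rewrite h.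
rewrite !normr_le0 !subr_eq0 => /eqP h2 /eqP h1.
by rewrite (surjective_pairing z) h1 h2 -surjective_pairing.
Qed.

Lemma cdist_gt0 z w : z <> w -> 0 < cdist z w.
Proof. by move=> h; rewrite lt0r cdist_ge0 andbT; apply/eqP => /cdist_eq0. Qed.

Lemma cdist_lip z w q : `|cdist z q - cdist w q| <= cdist z w.
Proof.
have := cdist_triangle z w q; have := cdist_triangle w z q.
by rewrite (cdistC w z) => h1 h2; rewrite ler_norml; apply/andP; split; lra.
Qed.

Lemma near_cdist z (e : R) : 0 < e -> \forall w \near z, cdist z w < e.
Proof.
move=> e0; have e3 : 0 < e / 3 by rewrite divr_gt0.
near=> w; have : ball z (e / 3) w by near: w; exact: nbhsx_ballx.
move=> [/= b1 b2]; apply: (@le_lt_trans _ _ (2 * (e / 3))); last lra.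
by apply: cdist_le; rewrite ?ltW.
Unshelve. all: by end_near. Qed.

(** The balls of the product topology are squares; this bridge lets every later topological argument
    use round discs. *)
Lemma near_cdistP z (P : set C) :
  (\forall w \near z, P w) <-> exists2 e : R, 0 < e & forall w, cdist z w < e -> P w.
Proof.
split=> [/nbhs_ballP [e /= e0 h]|[e e0 h]]; last first.
  by apply: filterS (near_cdist z e0) => w; exact: h.
exists e => // w hw; apply: h; split => /=.
  exact: le_lt_trans (cdist_fst _ _) hw.
exact: le_lt_trans (cdist_snd _ _) hw.
Qed.

Lemma openCP (U : set C) : open U <->
  forall z, U z -> exists2 e : R, 0 < e & forall w, cdist z w < e -> U w.
Proof.
rewrite openE; split => h z /h; first by move/near_cdistP.
by move=> hz; apply/near_cdistP.
Qed.

Lemma cdist_continuous q : continuous (fun z => cdist z q).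
Proof.
move=> z; apply/cvgrPdist_lt => e e0; near=> w.
apply: (le_lt_trans (cdist_lip z w q)); near: w; exact: near_cdist.
Unshelve. all: by end_near. Qed.

Lemma closed_far (K : set C) z : closed K -> ~ K z ->
  exists2 e : R, 0 < e & forall w, K w -> e <= cdist z w.
Proof.
move=> cK Kz; have /openCP /(_ z Kz) [e e0 h] : open (~` K) by exact: closed_openC.
by exists e => // w Kw; rewrite leNgt; apply/negP => /h.
Qed.

Lemma closedC_ge q r : closed [set z | r <= cdist z q].
Proof.
apply: (@preimage_closed _ _ (fun z => cdist z q) [set x | r <= x]).
  by move=> z _; exact: cdist_continuous.
exact: closed_ge.
Qed.

Lemma compactC_bounded (K : set C) q : compact K ->
  exists2 d : R, 0 < d & forall z, K z -> cdist z q < d.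
Proof.
move=> cK; have [Ke|[z0 Kz0]] : K = set0 \/ K !=set0 by case: (eqVneq K set0) => [|/set0P]; [left|right].
  by exists 1 => // z; rewrite Ke.
have [c /set_mem Kc h] := @compact_EVT_max _ R (fun z => cdist z q) K
  (ex_intro _ _ Kz0) cK (continuous_subspaceT (@cdist_continuous q)).
exists (cdist c q + 1); first by rewrite ltr_wpDl // cdist_ge0.
by move=> z Kz; rewrite (le_lt_trans (h z (mem_set Kz))) // ltrDl.
Qed.

Lemma circE_dist z r t : 0 <= r -> cdist z (circ z r t) = r.
Proof.
move=> r0; rewrite /cdist /circ /=.
rewrite (_ : _ + _ = r ^+ 2 * (cos t ^+ 2 + sin t ^+ 2)); last by ring.
by rewrite cos2Dsin2 mulr1 sqrtr_sqr ger0_norm.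
Qed.

Lemma circ_continuous z r : continuous (circ z r).
Proof.
move=> t.
have h1 : (z.1 + r * cos u) @[u --> t] --> z.1 + r * cos t.
  apply: cvgD; first exact: cvg_cst.
  by apply: cvgM; [exact: cvg_cst|exact: continuous_cos].
have h2 : (z.2 + r * sin u) @[u --> t] --> z.2 + r * sin t.
  apply: cvgD; first exact: cvg_cst.
  by apply: cvgM; [exact: cvg_cst|exact: continuous_sin].
exact: (cvg_pair h1 h2).
Qed.

Lemma polar_coord (x y : R) : exists t : R,
  [/\ 0 <= t, t <= 2 * pi, x = Num.sqrt (x ^+ 2 + y ^+ 2) * cos t &
      y = Num.sqrt (x ^+ 2 + y ^+ 2) * sin t].
Proof.
set d := Num.sqrt _.
have d0 : 0 <= d by exact: sqrtr_ge0.
have d2 : d ^+ 2 = x ^+ 2 + y ^+ 2 by rewrite sqr_sqrtr // addr_ge0 // sqr_ge0.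
have pi0 := pi_ge0 R.
have [dz|dz] := eqVneq d 0.
  exists 0; rewrite dz !mul0r; move: d2; rewrite dz expr0n /= => d2.
  have := sqr_ge0 x; have := sqr_ge0 y => hy hx.
  have /eqP : x ^+ 2 = 0 by lra.
  have /eqP : y ^+ 2 = 0 by lra.
  by rewrite !sqrf_eq0 => /eqP -> /eqP ->; split => //; rewrite mulr_ge0.
have dp : 0 < d by rewrite lt0r dz.
have hx : -1 <= x / d <= 1.
  rewrite -ler_norml normrM normfV (ger0_norm d0) ler_pdivrMr // mul1r.
  rewrite -(@ler_pXn2r _ 2) ?nnegrE // real_normK ?num_real // d2 lerDl.
  exact: sqr_ge0.
have hc : d * cos (acos (x / d)) = x by rewrite acosK // mulrC divfK.
have hs : d * sin (acos (x / d)) = `|y|.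
  rewrite sin_acos // -[in LHS](ger0_norm d0) -sqrtr_sqr -sqrtrM ?sqr_ge0 //.
  rewrite -sqrtr_sqr; congr Num.sqrt.
  rewrite sqrtr_sqr ger0_norm //.
  have -> : d ^+ 2 * (1 - (x / d) ^+ 2) = d ^+ 2 - x ^+ 2 by field.
  by rewrite d2; ring.
have h1 := acos_ge0 hx; have h2 := acos_lepi hx.
have [y0|y0] := leP 0 y.
  exists (acos (x / d)); split => //; first by rewrite (le_trans h2) //; lra.
  by rewrite hs ger0_norm.
exists (pi *+ 2 - acos (x / d)); split; [lra|lra| |].
- by rewrite cosB cos2pi sin2pi mul1r mul0r addr0.
- rewrite sinB cos2pi sin2pi mul1r mul0r sub0r mulrN hs ltr0_norm //; lra.
Qed.

End Plane.

(** * Integration tools: monotonicity and antiderivatives *)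

Section Integral.
Context d (T : measurableType d) (R : realType).
Variable mu : {measure set T -> \bar R}.

(** Measurability does not enter: the integral is a difference of suprema over simple functions
    below the positive and negative parts, and each supremum is monotone. *)
Lemma integral_mono (A : set T) (f g : T -> \bar R) :
  (forall x, A x -> (f x <= g x)%E) ->
  (\int[mu]_(x in A) f x <= \int[mu]_(x in A) g x)%E.
Proof.
move=> fg.
have fgA x : ((f \_ A) x <= (g \_ A) x)%E.
  by rewrite /patch; case: ifPn => // /set_mem; exact: fg.
rewrite /integral /=; apply: leeB; apply: le_ereal_sup => _ [h /= hf <-];
  exists h => //= x; apply: (le_trans (hf x)).
- by apply: (@funepos_le _ _ setT) (in_setT x) => y _; exact: fgA.
- by apply: (@funeneg_le _ _ setT) (in_setT x) => y _; exact: fgA.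
Qed.

End Integral.

Section Antiderivative.
Variable R : realType.
Implicit Types (f F : R -> R) (a b x c : R).

(** The primitive starts at $-1$ so that it has a two-sided derivative at $0$, the left end of the
    interval of angles. *)
Lemma antiderivative f : continuous f ->
  exists F, forall x, -1 < x -> is_derive x 1 F (f x).
Proof.
move=> cf; exists (fun x => \int[lebesgue_measure]_(t in `[-1, x]) f t) => x x1.
have [h1 h2] : derivable (fun x => \int[lebesgue_measure]_(t in `[-1, x]) f t) x 1 /\
    (fun x => \int[lebesgue_measure]_(t in `[-1, x]) f t)^`()%classic x = f x.
  apply: (@continuous_FTC1 R f (BLeft (-1)) x (x + 1)) => //.
  - by rewrite ltrDl.
  - apply: continuous_compact_integrable; first exact: segment_compact.
    exact: continuous_subspaceT.
  - exact: cf.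
by apply: DeriveDef => //; rewrite -derive1E.
Qed.

Lemma integral_antiderivative f F a b : continuous f -> -1 < a -> a < b ->
  (forall x, -1 < x -> is_derive x 1 F (f x)) ->
  (\int[lebesgue_measure]_(x in `[a, b]) (f x)%:E = (F b - F a)%:E)%E.
Proof.
move=> cf a1 ab dF; rewrite EFinB; apply: continuous_FTC2 => //.
- exact: continuous_subspaceT.
- split=> [x| |].
  + by rewrite in_itv /= => /andP[ax _]; apply: ex_derive; apply: dF; lra.
  + apply: cvg_at_right_filter; apply: differentiable_continuous.
    by apply/derivable1_diffP; apply: ex_derive; exact: dF.
  + apply: cvg_at_left_filter; apply: differentiable_continuous.
    by apply/derivable1_diffP; apply: ex_derive; apply: dF; lra.
- move=> x; rewrite in_itv /= => /andP[ax _].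
  by rewrite derive1E; apply: derive_val; apply: dF; lra.
Qed.

Lemma is_derive0_const F a b : a < b ->
  (forall x, a <= x -> is_derive x 1 F 0) -> F b = F a.
Proof.
move=> ab dF.
have d0 x : x \in `]a, b[ -> is_derive x 1 F 0.
  by rewrite in_itv /= => /andP[/ltW ax _]; exact: dF.
have cF : {within `[a, b], continuous F}.
  apply: derivable_within_continuous => x; rewrite in_itv /= => /andP[ax _].
  by apply: ex_derive; exact: dF.
have [c _] := MVT ab d0 cF.
by rewrite mul0r => /eqP; rewrite subr_eq0 => /eqP.
Qed.

End Antiderivative.

(** * The mean value property of $\log|z-q|$ *)

Section LogMean.
Variable R : realType.
Notation C := (R * R)%type.
Implicit Types (s t x y : R).

Lemma lnq_arg s t : 0 <= s -> (1 - s) ^+ 2 <= 1 + 2 * s * cos t + s ^+ 2 <= (1 + s) ^+ 2.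
Proof.
move=> s0; have := cos_geN1 t; have := cos_le1 t => h1 h2.
by apply/andP; split; nra.
Qed.

(** This is $\log|1+se^{it}|^2$. *)
Definition lnq s t := ln (1 + 2 * s * cos t + s ^+ 2).

Lemma lnq_arg_gt0 s t : 0 <= s < 1 -> 0 < 1 + 2 * s * cos t + s ^+ 2.
Proof.
move=> /andP[s0 s1]; have /andP[h _] := lnq_arg t s0; apply: lt_le_trans h.
by rewrite exprn_gt0 // subr_gt0.
Qed.

Lemma lnq_continuous s : 0 <= s < 1 -> continuous (lnq s).
Proof.
move=> hs t.
change {for t, continuous (@ln R \o (fun t => 1 + 2 * s * cos t + s ^+ 2))}.
apply: continuous_comp; last by apply: continuous_ln; exact: lnq_arg_gt0.
apply: cvgD; last exact: cvg_cst.
apply: cvgD; first exact: cvg_cst.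
by apply: cvgM; [exact: cvg_cst|exact: continuous_cos].
Qed.

(* |1 + w| |1 - w| = |1 - w^2| *)
Lemma lnq_double s t : 0 <= s < 1 ->
  lnq s t + lnq s (t + pi) = lnq (s ^+ 2) (2 * t + pi).
Proof.
move=> hs; have s21 : 0 <= s ^+ 2 < 1.
  by case/andP: hs => s0 s1; rewrite sqr_ge0 /= expr_lt1.
rewrite /lnq -lnM ?posrE ?lnq_arg_gt0 //; congr ln.
have -> : cos (t + pi) = - cos t by exact: cosDpi.
have -> : cos (2 * t + pi) = - cos (2 * t) by exact: cosDpi.
have -> : cos (2 * t) = 2 * cos t ^+ 2 - 1.
  by rewrite mulrDl mul1r cosD -!expr2; have := cos2Dsin2 t; lra.
ring.
Qed.

Lemma is_derive_affine (f : R -> R) k c x a : is_derive (k * x + c) 1 f a ->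
  is_derive x 1 (fun t => f (k * t + c)) (k * a).
Proof.
move=> df; have dg : is_derive x 1 (fun t => k * t + c) k.
  have : is_derive x 1 (fun t : R => k * t + c) (k *: 1 + 0).
    by apply: is_deriveD.
  by move=> /is_derive_eq; apply; rewrite addr0 [_ *: 1]mulr1.
have := @is_derive1_comp _ f (fun t => k * t + c) x a k df dg.
by rewrite mulrC.
Qed.

Lemma is_derive_shift (f : R -> R) c x a : is_derive (x + c) 1 f a ->
  is_derive x 1 (fun t => f (t + c)) a.
Proof.
rewrite -{1}(mul1r x) => /is_derive_affine; rewrite mul1r.
by under eq_fun do rewrite mul1r.
Qed.

Lemma antiderivative_periodic (f F : R -> R) x :
  (forall t, f (t + 2 * pi) = f t) ->
  (forall x, -1 < x -> is_derive x 1 F (f x)) ->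
  0 <= x -> F (x + 2 * pi) - F x = F (2 * pi) - F 0.
Proof.
move=> fp dF; rewrite le_eqVlt => /predU1P[<-|x0]; first by rewrite add0r.
pose G t := F (t + 2 * pi) - F t.
rewrite -[LHS]/(G x) -[in RHS](add0r (2 * pi)) -[RHS]/(G 0).
apply: is_derive0_const => // y y0; have y1 : -1 < y by lra.
have := pi_ge0 R => pi0.
have dy := dF y y1.
have dy2 : is_derive (y + 2 * pi) 1 F (f (y + 2 * pi)) by apply: dF; lra.
have : is_derive y 1 G (f (y + 2 * pi) - f y).
  by apply: is_deriveB; exact: is_derive_shift.
by move=> /is_derive_eq; apply; rewrite fp subrr.
Qed.

Lemma lnq_period s t : lnq s (t + 2 * pi) = lnq s t.
Proof. by rewrite /lnq [2 * pi]mulr_natl cosD2pi. Qed.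

Lemma lnq_shift s x (F : R -> R) : 0 <= s < 1 ->
  (forall x, -1 < x -> is_derive x 1 F (lnq s x)) -> 0 <= x ->
  F (x + 2 * pi) - F x = F (2 * pi) - F 0.
Proof.
by move=> hs dF x0; exact: antiderivative_periodic (lnq_period s) dF x0.
Qed.

Definition lnqI s : R := \int[lebesgue_measure]_(t in `[0, 2 * pi]) lnq s t.

Lemma lnqI_E s (F : R -> R) : 0 <= s < 1 ->
  (forall x, -1 < x -> is_derive x 1 F (lnq s x)) -> lnqI s = F (2 * pi) - F 0.
Proof.
move=> hs dF; rewrite /lnqI /Rintegral (integral_antiderivative _ _ _ dF) //.
- exact: lnq_continuous.
- by have := pi_gt0 R; lra.
Qed.

(** Integrate [lnq_double] over a period. The shift by $\pi$ does not change the integral of a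
    periodic function, and $2t+\pi$ runs through two periods at double speed. The computation is
    done on antiderivatives, where [H] is constant. *)
Lemma lnqI_double s : 0 <= s < 1 -> 2 * lnqI s = lnqI (s ^+ 2).
Proof.
move=> hs; have s2 : 0 <= s ^+ 2 < 1.
  by case/andP: hs => s0 s1; rewrite sqr_ge0 /= expr_lt1.
have [P dP] := antiderivative (lnq_continuous hs).
have [Q dQ] := antiderivative (lnq_continuous s2).
have pi0 := pi_gt0 R.
rewrite (lnqI_E hs dP) (lnqI_E s2 dQ).
pose H t := P t + P (t + pi) - 2^-1 * Q (2 * t + pi).
have : H (2 * pi) = H 0.
  apply: is_derive0_const => [|y y0]; [lra|have y1 : -1 < y by lra].
  have d1 := dP y y1.
  have d2 : is_derive (y + pi) 1 P (lnq s (y + pi)) by apply: dP; lra.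
  have d3 : is_derive (2 * y + pi) 1 Q (lnq (s ^+ 2) (2 * y + pi)) by apply: dQ; lra.
  have d2' : is_derive y 1 (fun t => P (t + pi)) (lnq s (y + pi)).
    exact: is_derive_shift.
  have d3' : is_derive y 1 (fun t => Q (2 * t + pi)) (2 * lnq (s ^+ 2) (2 * y + pi)).
    exact: is_derive_affine.
  have : is_derive y 1 H (lnq s y + lnq s (y + pi)
     - 2^-1 *: (2 * lnq (s ^+ 2) (2 * y + pi))).
    exact: is_deriveB.
  move=> /is_derive_eq; apply; rewrite -lnq_double // [_ *: _]mulrA.
  by rewrite mulVf // mul1r subrr.
rewrite /H mulr0 !add0r.
have pi3 : 0 <= pi + 2 * pi :> R by lra.
have := lnq_shift hs dP (ltW pi0).
have := lnq_shift s2 dQ (ltW pi0).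
have := lnq_shift s2 dQ pi3.
rewrite (_ : 2 * (2 * pi) + pi = pi + 2 * pi + 2 * pi); last by ring.
rewrite (_ : 2 * pi + pi = pi + 2 * pi); last by ring.
lra.
Qed.

(** The point is uniformity over $[0,s_0]$, an interval that squaring maps into itself. *)
Lemma lnqI_bound s0 s : s0 < 1 -> 0 <= s <= s0 ->
  `|lnqI s| <= 2 * pi * (ln 4 - ln ((1 - s0) ^+ 2)).
Proof.
move=> s01 /andP[s00 ss0]; have hs : 0 <= s < 1 by lra.
have [P dP] := antiderivative (lnq_continuous hs).
rewrite (lnqI_E hs dP).
have pi0 := pi_gt0 R.
have ab : 0 < 2 * pi :> R by lra.
have d x : x \in `]0, 2 * pi[ -> is_derive x 1 P (lnq s x).
  by rewrite in_itv /= => /andP[x0 _]; apply: dP; lra.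
have cP : {within `[0, 2 * pi], continuous P}.
  apply: derivable_within_continuous => x; rewrite in_itv /= => /andP[x0 _].
  by apply: ex_derive; apply: dP; lra.
have [c _ ->] := MVT ab d cP.
rewrite normrM subr0 (gtr0_norm ab) mulrC ler_pM2l //.
have /andP[h1 h2] := lnq_arg c s00.
have p0 : 0 < (1 - s0) ^+ 2 by rewrite exprn_gt0 // subr_gt0.
have h3 : (1 - s0) ^+ 2 <= (1 - s) ^+ 2 by nra.
have h4 : (1 + s) ^+ 2 <= 4 by nra.
have pq := lnq_arg_gt0 c hs.
have l1 : ln ((1 - s0) ^+ 2) <= lnq s c.
  by rewrite ler_ln ?posrE //; lra.
have l2 : lnq s c <= ln 4 by rewrite ler_ln ?posrE //; lra.
have l3 : ln ((1 - s0) ^+ 2) <= 0 by apply: ln_le0; nra.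
have l4 : 0 <= ln (4 : R) by apply: ln_ge0; lra.
by rewrite ler_norml; apply/andP; split; lra.
Qed.

(** Each squaring of $s$ doubles the integral, while all the values stay below one bound; so
    $2^n|I(s)|$ is bounded in $n$ and $I(s)=0$. *)
Lemma lnqI_eq0 s : 0 <= s < 1 -> lnqI s = 0.
Proof.
move=> /andP[s0 s1].
pose B : R := 2 * pi * (ln 4 - ln ((1 - s) ^+ 2)).
have iter n : exists2 u, 0 <= u <= s & lnqI u = 2 ^+ n * lnqI s.
  elim: n => [|n [u /andP[u0 us] hu]]; first by exists s; rewrite ?s0 ?lexx // mul1r.
  exists (u ^+ 2); first by rewrite sqr_ge0 /=; nra.
  by rewrite -lnqI_double ?hu ?exprS ?mulrA //; lra.
have hB n : 2 ^+ n * `|lnqI s| <= B.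
  rewrite -[2 ^+ n]ger0_norm ?exprn_ge0 // -normrM.
  by have [u hu <-] := iter n; exact: lnqI_bound.
apply/eqP; rewrite -normr_le0 leNgt; apply/negP => I0.
have [n hn] : exists n : nat, B / `|lnqI s| < n%:R.
  by exists (Num.trunc (B / `|lnqI s|)).+1; exact: truncnS_gt.
have := hB n; rewrite leNgt => /negP; apply.
rewrite -ltr_pdivrMr // (lt_le_trans hn) //.
by rewrite -natrX ler_nat ltnW // ltn_expl.
Qed.

Lemma ln_cdist_mean (z q : C) (r : R) : 0 <= r -> r < cdist z q ->
  (\int[lebesgue_measure]_(t in `[0%R, (2 * pi)%R]) (ln (cdist (circ z r t) q))%:E
   = (2 * pi * ln (cdist z q))%:E)%E.
Proof.
move=> r0 rq; set D := cdist z q in rq *.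
have D0 : 0 < D by exact: le_lt_trans rq.
pose s := r / D.
have hs : 0 <= s < 1 by rewrite divr_ge0 ?(ltW D0) //= ltr_pdivrMr // mul1r.
(* The sign of the second coordinate makes $z-q=De^{-i\theta}$, hence
   $|z+re^{it}-q|=D\,|1+se^{i(t+\theta)}|$ with $s=r/D$. *)
have [th [th0 _ h1 h2]] := polar_coord (z.1 - q.1) (- (z.2 - q.2)).
rewrite sqrrN -[Num.sqrt _]/(cdist z q) -/D in h1 h2.
have E t : ln (cdist (circ z r t) q) = ln D + 2^-1 * lnq s (t + th).
  have p1 := lnq_arg_gt0 (t + th) hs.
  have -> : cdist (circ z r t) q = D * Num.sqrt (1 + 2 * s * cos (t + th) + s ^+ 2).
    have D0' := ltW D0.
    rewrite -[D in RHS](ger0_norm D0') -sqrtr_sqr -sqrtrM ?sqr_ge0 //.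
    congr Num.sqrt; rewrite /circ /= cosD /s.
    have e1 : z.1 = q.1 + D * cos th by lra.
    have e2 : z.2 = q.2 - D * sin th by lra.
    have dn : D != 0 by rewrite gt_eqF.
    have ct := cos2Dsin2 t; have cth := cos2Dsin2 th.
    rewrite e1 e2; apply/eqP; rewrite -subr_eq0; apply/eqP.
    transitivity (D ^+ 2 * (cos th ^+ 2 + sin th ^+ 2 - 1)
       + r ^+ 2 * (cos t ^+ 2 + sin t ^+ 2 - 1)); first by field.
    by rewrite ct cth subrr !mulr0 addr0.
  have sq0 : 0 < Num.sqrt (1 + 2 * s * cos (t + th) + s ^+ 2) by rewrite sqrtr_gt0.
  rewrite lnM ?posrE //; congr (_ + _).
  have -> : lnq s (t + th) = ln (Num.sqrt (1 + 2 * s * cos (t + th) + s ^+ 2) ^+ 2).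
    by rewrite sqr_sqrtr // ltW.
  by rewrite lnXn //; move: (ln (Num.sqrt _)) => l; field.
have [P dP] := antiderivative (lnq_continuous hs).
pose F t := ln D * t + 2^-1 * P (t + th).
have dF x : -1 < x -> is_derive x 1 F (ln (cdist (circ z r x) q)).
  move=> x1; rewrite E.
  have d2 : is_derive (x + th) 1 P (lnq s (x + th)) by apply: dP; lra.
  have d2' : is_derive x 1 (fun t => P (t + th)) (lnq s (x + th)).
    exact: is_derive_shift.
  have : is_derive x 1 F (ln D *: 1 + 2^-1 *: lnq s (x + th)).
    exact: is_deriveD.
  by move=> /is_derive_eq; apply; rewrite [_ *: 1]mulr1.
rewrite (integral_antiderivative _ _ _ dF) //.
- have e1 := lnq_shift hs dP th0; have e2 := lnqI_E hs dP.
  rewrite lnqI_eq0 // in e2; congr EFin.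
  by rewrite /F add0r mulr0 (addrC (2 * pi) th); lra.
- rewrite (_ : (fun t => _) = (fun t => ln D + 2^-1 * lnq s (t + th))); last exact/funext.
  move=> t; apply: cvgD; first exact: cvg_cst.
  apply: cvgM; first exact: cvg_cst.
  change {for t, continuous (lnq s \o (fun t => t + th))}.
  apply: continuous_comp; last exact: lnq_continuous.
  by apply: cvgD; [exact: cvg_id|exact: cvg_cst].
- by have := pi_gt0 R; lra.
Qed.

End LogMean.

(** * Subharmonic functions: locality, maxima, sums and positive multiples *)

Section Subharmonic.
Variable R : realType.
Notation C := (R * R)%type.
Implicit Types (U V : set C) (u v : C -> \bar R) (z w q : C) (r c k : R).

Notation cint u z r :=
  (\int[lebesgue_measure]_(t in `[0%R, (2 * pi)%R]) u (circ z r t))%E.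

Lemma twopi_gt0 : 0 < 2 * pi :> R.
Proof. by have := pi_gt0 R; lra. Qed.

Lemma measure_circ_itv : lebesgue_measure (`[0%R, (2 * pi)%R] : set (measurableTypeR R)) = (2 * pi)%:E.
Proof. by rewrite lebesgue_measure_itv /= lte_fin twopi_gt0 oppr0 adde0. Qed.

Lemma mean_cst c :
  (((2 * pi)^-1)%:E * \int[lebesgue_measure]_(t in `[0%R, (2 * pi)%R]) c%:E = c%:E :> \bar R)%E.
Proof.
have pi0 := twopi_gt0.
rewrite integral_cst; last exact: measurable_itv.
rewrite (_ : (lebesgue_measure : {measure set (measurableTypeR R) -> \bar R}) _ = (2 * pi)%:E); last exact: measure_circ_itv.
by rewrite -!EFinM mulrCA mulVf ?mulr1 // gt_eqF.
Qed.

Definition disc_in U z (e : R) := forall w, cdist z w < e -> U w.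

Lemma disc_in_circ U z e r t : disc_in U z e -> 0 <= r -> r < e -> U (circ z r t).
Proof. by move=> h r0 re; apply: h; rewrite circE_dist. Qed.

Lemma subharmonic_open U u : subharmonic U u -> open U.
Proof.
move=> [_ _ h]; apply/openCP => z /h [e e0 [hU _]]; by exists e.
Qed.

Lemma subharmonic_ext U u v : (forall z, U z -> u z = v z) ->
  subharmonic U u -> subharmonic U v.
Proof.
move=> uv su; have oU := subharmonic_open su; case: su => h1 h2 h3; split.
- by move=> z Uz; rewrite -uv //; exact: h1.
- move=> z Uz c; rewrite -uv // => /(h2 z Uz) huc.
  have nU : \forall w \near z, U w by exact: open_nbhs_nbhs.
  by apply: filterS2 huc nU => w ? Uw; rewrite -uv.
- move=> z Uz; have [e e0 [hU he]] := h3 z Uz; exists e => //; split=> // r r0 re.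
  rewrite -uv //; apply: (le_trans (he r r0 re)).
  rewrite lee_pmul2l ?lte_fin ?invr_gt0 ?twopi_gt0 //.
  apply: integral_mono => t _.
  by rewrite uv //; exact: (disc_in_circ _ hU).
Qed.

Lemma subharmonic_sub U V u : open V -> V `<=` U -> subharmonic U u -> subharmonic V u.
Proof.
move=> /openCP oV VU [h1 h2 h3]; split.
- by move=> z /VU; exact: h1.
- by move=> z /VU; exact: h2.
- move=> z Vz; have [e e0 [hU he]] := h3 z (VU _ Vz); have [e' e'0 hV] := oV z Vz.
  exists (Num.min e e'); first by rewrite lt_min e0.
  split=> [w|r r0]; rewrite lt_min => /andP[h h']; first exact: hV.
  exact: he.
Qed.

Lemma subharmonic_setU U V u : subharmonic U u -> subharmonic V u ->
  subharmonic (U `|` V) u.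
Proof.
move=> [u1 u2 u3] [v1 v2 v3]; split.
- by move=> z [/u1|/v1].
- by move=> z [/u2|/v2].
- move=> z [/u3|/v3] [e e0 [hU he]]; exists e => //; split => // w /hU; by [left|right].
Qed.

Lemma subharmonic_local U u : (forall z, U z -> exists V, [/\ V z, V `<=` U & subharmonic V u]) ->
  subharmonic U u.
Proof.
move=> h; split => z /h [V [Vz VU [v1 v2 v3]]]; [exact: v1|exact: v2|].
have [e e0 [hV he]] := v3 z Vz; exists e => //; split => // w /hV; exact: VU.
Qed.

Lemma subharmonic_cst U c : open U -> subharmonic U (fun=> c%:E).
Proof.
move=> oU; split => [z _|z _ d hd|z Uz].
- exact: ltry.
- by near=> w.
- have /openCP /(_ z Uz) [e e0 hU] := oU; exists e => //; split => // r _ _.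
  by rewrite mean_cst.
Unshelve. all: by end_near. Qed.

Lemma subharmonic_max U u v : subharmonic U u -> subharmonic U v ->
  subharmonic U (fun z => maxe (u z) (v z)).
Proof.
move=> [u1 u2 u3] [v1 v2 v3]; split.
- by move=> z Uz; rewrite gt_max u1 ?v1.
- move=> z Uz c; rewrite gt_max => /andP[uc vc].
  by apply: filterS2 (u2 z Uz c uc) (v2 z Uz c vc) => w h1 h2; rewrite gt_max h1.
- move=> z Uz; have [e e0 [hU he]] := u3 z Uz; have [e' e'0 [hU' he']] := v3 z Uz.
  exists (Num.min e e'); first by rewrite lt_min e0.
  split=> [w|r r0]; rewrite lt_min => /andP[h h']; first exact: hU.
  have i0 : (0 < ((2 * pi)^-1 : R)%:E)%E by rewrite lte_fin invr_gt0 twopi_gt0.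
  rewrite ge_max; apply/andP; split.
    apply: (le_trans (he r r0 h)); rewrite lee_pmul2l //.
    by apply: integral_mono => t _; rewrite le_max lexx.
  apply: (le_trans (he' r r0 h')); rewrite lee_pmul2l //.
  by apply: integral_mono => t _; rewrite le_max lexx orbT.
Qed.

Section Circle.
Variables (U : set C) (u : C -> \bar R) (z : C) (e r : R).
Hypotheses (su : subharmonic U u) (hU : disc_in U z e) (r0 : 0 <= r) (re : r < e).

Lemma circ_usc (t c : R) : (u (circ z r t) < c%:E)%E ->
  \forall s \near t, (u (circ z r s) < c%:E)%E.
Proof.
case: su => _ h _ hc.
have := h _ (disc_in_circ t hU r0 re) c hc.
exact: (@circ_continuous R z r t).
Qed.

Lemma circ_measurable (D : set R) : measurable D ->
  measurable_fun D (fun t : R => u (circ z r t) : \bar R).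
Proof.
move=> mD; apply: (@measurable_funS _ _ _ _ setT) => //.
have mN : measurable_fun setT (fun t : R => (- u (circ z r t))%E : \bar R).
  apply: lower_semicontinuous_measurable => t c.
  rewrite lteNr -EFinN => /circ_usc h.
  exists [set s | (u (circ z r s) < (- c)%:E)%E]; first exact: h.
  by move=> s /=; rewrite lteNr.
rewrite (_ : (fun t => _) = (fun t : R => - (- u (circ z r t)) : \bar R)%E); last first.
  by apply/funext => t; rewrite oppeK.
exact: measurableT_comp mN.
Qed.

(** The sets where $u<n$ form an open cover of the compact interval of angles, by upper
    semicontinuity and $u<+\infty$. *)
Lemma circ_bounded : exists2 M : R, 0 <= M &
  forall t, 0 <= t <= 2 * pi -> (u (circ z r t) <= M%:E)%E.
Proof.
have cK : compact `[0, 2 * pi :> R] by exact: segment_compact.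
have := cK; rewrite compact_cover => /(_ nat setT
  (fun n => [set t | (u (circ z r t) < n%:R%:E)%E])) [].
- by move=> n _; rewrite openE => t; exact: circ_usc.
- move=> t _ /=; have : (u (circ z r t) < +oo)%E.
    by case: su => h _ _; exact: h (disc_in_circ t hU r0 re).
  case E: (u (circ z r t)) => [x| |] // _.
    by exists (Num.trunc x).+1 => //=; rewrite E lte_fin truncnS_gt.
  by exists 0%N => //=; rewrite E ltNyr.
(* The sum of the indices of the finite subcover serves as a crude upper bound for each of them. *)
- move=> D' _ h; exists (\sum_(n <- finmap.enum_fset D') n%:R) => [|t].
    exact: sumr_ge0.
  move=> ht; have [n /= nD /ltW hn] := h t ht; apply: (le_trans hn).
  rewrite lee_fin (big_rem n) //= lerDl; exact: sumr_ge0.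
Qed.

(** The positive part is bounded on the circle, so only the negative part could have infinite
    integral, and the hypothesis excludes that. *)
Lemma circ_integrable : (-oo < cint u z r)%E ->
  lebesgue_measure.-integrable `[0, 2 * pi] (fun t => u (circ z r t)).
Proof.
move=> hI; apply/integrableP.
have mI : measurable (`[0, 2 * pi] : set (measurableTypeR R)) by exact: measurable_itv.
have mf := circ_measurable mI; split => //.
have [M M0 hM] := circ_bounded.
have hp : (\int[lebesgue_measure]_(t in `[0%R, (2 * pi)%R])
    (fun t => u (circ z r t))^\+%E t < +oo)%E.
  apply: (@le_lt_trans _ _ (\int[lebesgue_measure]_(t in `[0%R, (2 * pi)%R]) M%:E)%E).
    apply: integral_mono => t; rewrite /= in_itv /= => ht.
    by rewrite funeposE ge_max lee_fin M0 andbT; exact: hM.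
  rewrite integral_cst // (_ : (lebesgue_measure : {measure set (measurableTypeR R) -> \bar R}) _ = (2 * pi)%:E); last exact: measure_circ_itv.
  by rewrite -EFinM ltry.
move: hI; rewrite integralE.
rewrite (_ : (fun t => `|u (circ z r t)|%E) =
   (fun t => (fun t => u (circ z r t))^\+%E t + (fun t => u (circ z r t))^\-%E t)%E); last first.
  by apply/funext => t; have := congr1 (fun f => f t) (fune_abse (fun t => u (circ z r t))).
have mp := measurable_funepos mf; have mn := measurable_funeneg mf.
rewrite ge0_integralD // => hI; apply: lte_add_pinfty => //.
rewrite ltey; apply/eqP => hy; move: hI; rewrite hy.
by case: (\int[_]_(_ in _) _)%E hp => // x _ /=; rewrite ltxx.
Qed.

End Circle.

(** This gives upper semicontinuity of a sum, with $-\infty$ allowed for either summand. *)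
Lemma lte_split (x y : \bar R) c : (x < +oo)%E -> (y < +oo)%E -> (x + y < c%:E)%E ->
  exists c1 c2 : R, [/\ (x < c1%:E)%E, (y < c2%:E)%E & c1 + c2 <= c].
Proof.
case: x y => [x| |] [y| |] //= _ _; rewrite ?lte_fin.
- move=> h; exists (x + (c - x - y) / 2), (y + (c - x - y) / 2).
  by rewrite !lte_fin; split; lra.
- by move=> _; exists (x + 1), (c - x - 1); rewrite lte_fin ltNyr; split => //; lra.
- by move=> _; exists (c - y - 1), (y + 1); rewrite lte_fin ltNyr; split => //; lra.
- by move=> _; exists 0, c; rewrite !ltNyr; split => //; lra.
Qed.

Lemma subharmonic_add U u v : subharmonic U u -> subharmonic U v ->
  subharmonic U (fun z => u z + v z)%E.
Proof.
move=> su sv; have [u1 u2 u3] := su; have [v1 v2 v3] := sv; split.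
- by move=> z Uz; apply: lte_add_pinfty; [exact: u1|exact: v1].
- move=> z Uz c /(lte_split (u1 _ Uz) (v1 _ Uz)) [c1 [c2 [uc vc hc]]].
  apply: filterS2 (u2 z Uz _ uc) (v2 z Uz _ vc) => w h1 h2.
  apply: (@lt_le_trans _ _ (c1 + c2)%:E%E); last by rewrite lee_fin.
  by rewrite EFinD lteD.
- move=> z Uz; have [e e0 [hU he]] := u3 z Uz; have [e' e'0 [hU' he']] := v3 z Uz.
  exists (Num.min e e'); first by rewrite lt_min e0.
  split=> [w|r r0]; rewrite lt_min => /andP[h h']; first exact: hU.
  have i0 : (0 < ((2 * pi)^-1 : R)%:E)%E by rewrite lte_fin invr_gt0 twopi_gt0.
  have hu := he r r0 h; have hv := he' r r0 h'.
  (* A centre value other than $-\infty$ forces the circle integral above $-\infty$. Both functions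
     are then integrable on the circle and the integral of the sum splits. *)
  have aux (x y : \bar R) : (x <= ((2 * pi)^-1)%R%:E * y)%E -> x <> -oo%E -> (-oo < y)%E.
    move=> hxy hx; rewrite ltNye; apply/eqP => hy; apply: hx; apply/eqP.
    by rewrite -leeNy_eq; apply: (le_trans hxy); rewrite hy gt0_muleNy.
  have [uz|uz] := eqVneq (u z) -oo%E; first by rewrite uz addNye leNye.
  have [vz|vz] := eqVneq (v z) -oo%E; first by rewrite vz addeNy leNye.
  have Iu := circ_integrable su hU r0 h (aux _ _ hu (elimN eqP uz)).
  have Iv := circ_integrable sv hU' r0 h' (aux _ _ hv (elimN eqP vz)).
  have mI : measurable (`[0, 2 * pi] : set (measurableTypeR R)) by exact: measurable_itv.
  rewrite (integralD mI) //.
  rewrite muleDr //; first exact: leeD.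
  have Fv := integrable_fin_num mI Iv.
  by rewrite fin_num_adde_defl.
Qed.

Lemma subharmonic_scale U u k : 0 < k -> subharmonic U u ->
  subharmonic U (fun z => k%:E * u z)%E.
Proof.
move=> k0 su; have [u1 u2 u3] := su; have k0' : (0 < k%:E)%E by rewrite lte_fin.
have kc (x : \bar R) c : (k%:E * x < c%:E)%E = (x < (c / k)%:E)%E.
  by rewrite -[in RHS](@lte_pmul2l _ k%:E) // -EFinM [k * _]mulrC divfK ?gt_eqF.
split.
- move=> z /u1; case: (u z) => [x _| //|_]; first by rewrite -EFinM ltry.
  by rewrite gt0_muleNy // ltNyr.
- move=> z Uz c; rewrite kc => /(u2 z Uz); apply: filterS => w; by rewrite kc.
- move=> z Uz; have [e e0 [hU he]] := u3 z Uz; exists e => //; split => // r r0 re.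
  have hu := he r r0 re.
  have [uz|uz] := eqVneq (u z) -oo%E; first by rewrite uz gt0_muleNy // leNye.
  have hI : (-oo < cint u z r)%E.
    rewrite ltNye; apply/eqP => hy; move/eqP: uz; apply; apply/eqP.
    rewrite -leeNy_eq; apply: (le_trans hu).
    by rewrite hy gt0_muleNy // lte_fin invr_gt0 twopi_gt0.
  have Iu := circ_integrable su hU r0 re hI.
  have mI : measurable (`[0, 2 * pi] : set (measurableTypeR R)) by exact: measurable_itv.
  rewrite (integralZl mI) //.
  by rewrite muleCA lee_pmul2l.
Qed.

End Subharmonic.

(** * Harmonic functions through the mean value property *)

Section Harmonic.
Variable R : realType.
Notation C := (R * R)%type.
Implicit Types (U V : set C) (g h : C -> R) (z w q : C) (r c k e : R).

(** Harmonicity is encoded by continuity and an exact, unnormalised mean value identity. It is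
    directly available for logarithms and stable under the finite sums and monotone limits used
    below. *)
Definition mean_harmonic U g :=
  (forall z, U z -> {for z, continuous g}) /\
  (forall z e r, disc_in U z e -> 0 <= r -> r < e ->
    (\int[lebesgue_measure]_(t in `[0%R, (2 * pi)%R]) (g (circ z r t))%:E
      = (2 * pi * g z)%:E)%E).

Lemma circ_comp_continuous U g z e r : mean_harmonic U g -> disc_in U z e ->
  0 <= r -> r < e -> continuous (fun t => g (circ z r t)).
Proof.
move=> [cg _] hU r0 re t; apply: (@continuous_comp _ _ _ (circ z r) g).
  exact: circ_continuous.
by apply: cg; exact: (disc_in_circ t hU).
Qed.

Lemma circ_comp_integrable U g z e r : mean_harmonic U g -> disc_in U z e ->
  0 <= r -> r < e ->
  lebesgue_measure.-integrable `[0, 2 * pi] (fun t => (g (circ z r t))%:E).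
Proof.
move=> hg hU r0 re.
apply: (@continuous_compact_integrable R (fun t => g (circ z r t))).
  exact: segment_compact.
by apply: continuous_subspaceT; exact: circ_comp_continuous hg hU r0 re.
Qed.

Lemma mean_harmonic_ln U q : ~ U q -> mean_harmonic U (fun z => ln (cdist z q)).
Proof.
move=> Uq; split => [z Uz|z e r hU r0 re].
  apply: (@continuous_comp _ _ _ (fun z => cdist z q) (@ln R)).
    exact: cdist_continuous.
  by apply/continuous_ln/cdist_gt0 => zq; apply: Uq; rewrite -zq.
apply: ln_cdist_mean => //; apply: (lt_le_trans re); rewrite leNgt.
by apply/negP => /hU.
Qed.

Lemma mean_harmonic_lin U g h (a b : R) : mean_harmonic U g -> mean_harmonic U h ->
  mean_harmonic U (fun z => a * g z + b * h z).
Proof.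
move=> hg hh; split=> [z Uz|z e r hU r0 re].
  by apply: cvgD; (apply: cvgM; first exact: cvg_cst); [exact: hg.1|exact: hh.1].
have mI : measurable (`[0, 2 * pi] : set (measurableTypeR R)) by exact: measurable_itv.
under eq_integral do rewrite EFinD !EFinM.
have Ig := circ_comp_integrable hg hU r0 re.
have Ih := circ_comp_integrable hh hU r0 re.
rewrite (integralD mI); [|exact: integrableZl|exact: integrableZl].
rewrite (integralZl mI) // (integralZl mI) // (hg.2 _ _ _ hU r0 re).
by rewrite (hh.2 _ _ _ hU r0 re) -!EFinM -EFinD; congr EFin; ring.
Qed.

Lemma mean_harmonic_subharmonic U g : open U -> mean_harmonic U g ->
  subharmonic U (fun z => (g z)%:E).
Proof.
move=> oU [cg mg]; split=> [z _|z Uz c|z Uz].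
- exact: ltry.
- rewrite lte_fin => gc.
  exact: (@cvgr_lt _ _ (nbhs z) _ g (g z) (cg z Uz) c gc).
- have /openCP /(_ z Uz) [e e0 hU] := oU; exists e => //; split => // r r0 re.
  rewrite (mg _ _ _ hU r0 re) -EFinM mulrA mulVf ?mul1r //.
  by rewrite gt_eqF // twopi_gt0.
Qed.

Lemma mean_harmonic0 U : mean_harmonic U (fun=> 0).
Proof.
split=> [z _|z e r _ _ _]; first exact: cvg_cst.
by rewrite mulr0 integral0_eq.
Qed.

Lemma mean_harmonic_sum U (I : eqType) (s : seq I) (g : I -> C -> R) :
  (forall i, i \in s -> mean_harmonic U (g i)) ->
  mean_harmonic U (fun z => \sum_(i <- s) g i z).
Proof.
elim: s => [|i s IH] hg.
  by under eq_fun do rewrite big_nil; exact: mean_harmonic0.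
rewrite (_ : (fun z => _) = (fun z => 1 * g i z + 1 * \sum_(j <- s) g j z)).
  apply: mean_harmonic_lin; first by apply: hg; rewrite mem_head.
  by apply: IH => j js; apply: hg; rewrite inE js orbT.
by apply/funext => z; rewrite big_cons !mul1r.
Qed.

(** The series is the increasing limit of continuous partial sums, so its negative is upper
    semicontinuous. Monotone convergence gives the mean value identity; the value $-\infty$ occurs
    where the series diverges. *)
Lemma subharmonic_nneseries U (g : nat -> C -> R) : open U ->
  (forall n, mean_harmonic U (g n)) -> (forall n z, U z -> 0 <= g n z) ->
  subharmonic U (fun z => - \sum_(0 <= k <oo) (g k z)%:E)%E.
Proof.
move=> oU hg g0.
have G0 z : U z -> (0 <= \sum_(0 <= k <oo) (g k z)%:E)%E.
  by move=> Uz; apply: nneseries_ge0 => k _ _; rewrite lee_fin g0.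
split=> [z Uz|z Uz c hc|z Uz].
- by rewrite lteNl /= (lt_le_trans _ (G0 z Uz)) // ltNye.
- have [n hn] : exists n, (- (c%:E) < \sum_(0 <= k < n) (g k z)%:E)%E.
    apply: contrapT => /forallNP hn; move: hc; rewrite ltNge => /negP; apply.
    rewrite leeNr; apply: lime_le.
      by apply: is_cvg_nneseries => k _ _; rewrite lee_fin g0.
    by apply: nearW => n; rewrite leNgt; apply/negP; exact: hn.
  have hs : mean_harmonic U (fun z => \sum_(0 <= k < n) g k z).
    by apply: mean_harmonic_sum => i _.
  move: hn; rewrite sumEFin -EFinN lte_fin => hn.
  have hw : \forall w \near z, - c < \sum_(0 <= k < n) g k w.
    exact: (@cvgr_gt _ _ (nbhs z) _ (fun z => \sum_(0 <= k < n) g k z) _ (hs.1 z Uz)).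
  have nU : \forall w \near z, U w by exact: open_nbhs_nbhs.
  apply: filterS2 hw nU => w hw Uw.
  rewrite lteNl; apply: (@lt_le_trans _ _ (\sum_(0 <= k < n) (g k w)%:E)%E).
    by rewrite sumEFin lte_fin.
  by apply: nneseries_lim_ge => k _ _; rewrite lee_fin g0.
- have /openCP /(_ z Uz) [e e0 hU] := oU; exists e => //; split => // r r0 re.
  have mI : measurable (`[0, 2 * pi] : set (measurableTypeR R)) by exact: measurable_itv.
  have Ut t : U (circ z r t) by exact: (disc_in_circ t hU).
  have fn0 : (\int[lebesgue_measure]_(t in `[0%R, (2 * pi)%R])
      (fun t => \sum_(0 <= k <oo) (g k (circ z r t))%:E)^\-%E t = 0)%E.
    apply: integral0_eq => t _.
    by rewrite funenegE; apply/max_idPr; rewrite leeNl oppe0; exact: G0.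
  rewrite integralN; last by rewrite fn0 oppe0 fin_num_adde_defl.
  rewrite integral_nneseries //; first last.
  + by move=> k t _; rewrite lee_fin g0.
  + move=> k; apply/measurable_EFinP; apply: (@measurable_funS _ _ _ _ setT) => //.
    by apply: continuous_measurable_fun; exact: circ_comp_continuous (hg k) hU r0 re.
  rewrite muleN leeN2.
  under eq_eseriesr do rewrite ((hg _).2 _ _ _ hU r0 re) EFinM.
  rewrite nneseriesZl; last by move=> k _; rewrite lee_fin g0.
  by rewrite muleA -EFinM mulVf ?mul1e // gt_eqF // twopi_gt0.
Qed.

End Harmonic.

(** * Circles that avoid a polar compact set *)

Section Radii.
Variable R : realType.
Notation C := (R * R)%type.

Lemma prod_lower (I : eqType) (s : seq I) (f : I -> R) (c : R) : 0 <= c ->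
  (forall i, i \in s -> c <= f i) -> c ^+ size s <= \prod_(i <- s) f i.
Proof.
move=> c0; elim: s => [|i s IH] h; first by rewrite big_nil.
rewrite big_cons exprS ler_pM ?exprn_ge0 //; first by rewrite h ?mem_head.
by apply: IH => j js; rewrite h // inE js orbT.
Qed.

(* Halve the interval, keep the middle of the half containing fewer roots: the
   discarded roots are at distance >= L / 8, and outnumber the remaining ones. *)
Lemma prod_dist_lower (n : nat) (s : seq R) (a L : R) : (size s <= n)%N -> 0 < L ->
  exists t : R, [/\ a <= t, t <= a + L &
    (L / 32) ^+ size s <= \prod_(x <- s) `|t - x|].
Proof.
elim: n s a L => [|n IH] s a L hs L0.
  move: hs; rewrite leqn0 size_eq0 => /eqP ->; exists a.
  by rewrite big_nil expr0; split => //; rewrite lerDl ltW.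
have step (p : pred R) (b : R) :
    (size [seq x <- s | p x] <= size [seq x <- s | predC p x])%N ->
    (forall t x, b <= t -> t <= b + L / 4 -> ~~ p x -> L / 8 <= `|t - x|) ->
    exists t, [/\ b <= t, t <= b + L / 4 &
      (L / 32) ^+ size s <= \prod_(x <- s) `|t - x|].
  move=> hk far; set s1 := [seq x <- s | p x] in hk *; set s2 := [seq x <- s | predC p x] in hk *.
  have hsz : (size s1 + size s2 = size s)%N by rewrite !size_filter count_predC.
  have [s0|sp] := posnP (size s).
    exists b; move/size0nil: s0 => ->; rewrite big_nil expr0.
    by split=> //; rewrite lerDl ltW // divr_gt0.
  have h1 : (size s1 <= n)%N.
    by move: hk sp hs; rewrite -hsz; lia.
  have L4 : 0 < L / 4 by rewrite divr_gt0.
  have [t [t1 t2 ht]] := IH s1 b (L / 4) h1 L4.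
  exists t; split => //.
  have -> : \prod_(x <- s) `|t - x| = (\prod_(x <- s1) `|t - x|) * \prod_(x <- s2) `|t - x|.
    by rewrite (bigID p) /= !big_filter.
  have h2 : (L / 8) ^+ size s2 <= \prod_(x <- s2) `|t - x|.
    apply: prod_lower => [|x]; first by rewrite divr_ge0 // ltW.
    by rewrite mem_filter => /andP[px _]; exact: far.
  (* With $l=L/32$ the two factors are $(l/4)^{k_1}$ and $(4l)^{k_2}$; since $k_1\le k_2$ their
     product is at least $l^{k_1+k_2}$. *)
  apply: (@le_trans _ _ ((L / 4 / 32) ^+ size s1 * (L / 8) ^+ size s2)); last first.
    by apply: ler_pM => //; rewrite exprn_ge0 // !divr_ge0 // ltW.
  have -> : L / 8 = 4 * (L / 32) by field.
  have -> : L / 4 / 32 = 4^-1 * (L / 32) by field.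
  have : 0 <= L / 32 by rewrite divr_ge0 // ltW.
  move: (L / 32) => l l0; rewrite !exprMn mulrACA -exprD hsz ler_peMl ?exprn_ge0 //.
  by rewrite exprVn mulrC ler_pdivlMr ?exprn_gt0 // mul1r ler_eXn2l // ltr1n.
pose p x := x < a + L / 2.
have [hk|hk] := leqP (size [seq x <- s | p x]) (size [seq x <- s | predC p x]).
  have [|t [t1 t2 ht]] := step _ (a + L / 8) hk.
    by move=> t x t1 t2; rewrite -leNgt => hx; rewrite distrC ger0_norm; lra.
  by exists t; split => //; lra.
have [||t [t1 t2 ht]] := step (predC p) (a + 5 * L / 8).
- rewrite (@eq_filter _ (predC (predC p)) p) ?(ltnW hk) //.
  by move=> x /=; rewrite negbK.
- move=> t x t1 t2; rewrite /= negbK => hx.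
  by rewrite ger0_norm; rewrite /p in hx; lra.
by exists t; split => //; lra.
Qed.

(** The map $w\mapsto|w-\zeta|$ is 1-Lipschitz, so a polynomial tiny on $K$ projects to one on the
    line tiny at every radius that $K$ attains. By [prod_dist_lower] it cannot be that small on a
    whole interval of radii. *)
Lemma polar_radius (K : set C) (zeta : C) (rho : R) :
  (forall M : R, exists s : seq C, s != [::] /\
     forall w, K w -> \prod_(q <- s) cdist w q < expR (- M * (size s)%:R)) ->
  0 < rho ->
  exists tau : R, [/\ 0 < tau, tau < rho & forall w, K w -> cdist w zeta != tau].
Proof.
move=> polK rho0; pose L := rho / 2; have L0 : 0 < L by rewrite divr_gt0.
(* This choice of $M$ makes $e^{-Mn}=(L/32)^n$, the bound of [prod_dist_lower]. *)
have [s [s0 hs]] := polK (- ln (L / 32)).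
have [t [t1 t2 ht]] := @prod_dist_lower (size s) [seq cdist q zeta | q <- s]
  (rho / 4) L ltac:(by rewrite size_map) L0.
exists t; split; [lra|rewrite /L in t2; lra|move=> w Kw].
apply/negP => /eqP wt; move: ht; rewrite size_map big_map leNgt => /negP; apply.
have := hs w Kw; rewrite opprK expRM_natr lnK ?posrE ?divr_gt0 // => hw.
apply: le_lt_trans hw; rewrite -wt; elim: {s0 hs t1 t2 wt} s => [|q s IH].
  by rewrite !big_nil.
rewrite !big_cons; apply: ler_pM => //.
- by apply: prodr_ge0 => x _.
- by rewrite (cdistC w zeta) (cdistC q zeta) !(cdistC zeta); exact: cdist_lip.
Qed.

Lemma compact_annulus (K : set C) (zeta : C) (tau : R) : compact K ->
  (forall w, K w -> cdist w zeta != tau) ->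
  exists2 e : R, 0 < e & forall w, K w -> e <= `|cdist w zeta - tau|.
Proof.
move=> cK hK.
have [Ke|K0] : K = set0 \/ K !=set0 by case: (eqVneq K set0) => [|/set0P]; [left|right].
  by exists 1 => // w; rewrite Ke.
have cf : {within K, continuous (fun w => - `|cdist w zeta - tau|)}.
  apply: continuous_subspaceT => w; apply: cvgN; apply: cvg_norm.
  by apply: cvgB; [exact: cdist_continuous|exact: cvg_cst].
have [c /set_mem Kc hc] := compact_EVT_max K0 cK cf.
exists (`|cdist c zeta - tau|); first by rewrite normr_gt0 subr_eq0 hK.
by move=> w Kw; have := hc w (mem_set Kw); rewrite lerN2.
Qed.

End Radii.

(** * Weights on binary words realised as lengths of nested intervals *)

Section Tree.
Variable R : realType.
Variable m : seq bool -> R.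
Hypothesis m_nil : m [::] = 1.
Hypothesis m_ge0 : forall s, 0 <= m s.
Hypothesis m_split : forall s, m s = m (rcons s false) + m (rcons s true).
Implicit Types (s : seq bool) (x : R).

(** When $[0,1)$ is cut again and again in proportion to [m], this is the left end of the interval
    of [s]: each bit [true] steps over the mass of the [false] sibling. [tree_path] reads off the
    address of a point in this subdivision. *)
Definition tree_lo s : R :=
  \sum_(i < size s) (if nth false s i then m (rcons (take i s) false) else 0).

Fixpoint tree_path x (j : nat) : seq bool :=
  if j is j'.+1 then
    rcons (tree_path x j') (tree_lo (tree_path x j') + m (rcons (tree_path x j') false) <= x)
  else [::].

Lemma tree_lo_rcons s b :
  tree_lo (rcons s b) = tree_lo s + (if b then m (rcons s false) else 0).
Proof.
rewrite /tree_lo size_rcons big_ord_recr /= nth_rcons ltnn eqxx -cats1 take_size_cat //.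
congr (_ + _); apply: eq_bigr => i _.
by rewrite nth_cat ltn_ord takel_cat // ltnW.
Qed.

Lemma size_tree_path x j : size (tree_path x j) = j.
Proof. by elim: j => //= j IH; rewrite size_rcons IH. Qed.

Lemma take_tree_path x j k : (j <= k)%N -> take j (tree_path x k) = tree_path x j.
Proof.
elim: k => [|k IH]; first by rewrite leqn0 => /eqP ->.
rewrite leq_eqVlt => /predU1P[->|]; first by rewrite take_oversize // size_tree_path.
by move=> jk; rewrite /= -cats1 takel_cat ?IH // size_tree_path.
Qed.

Lemma tree_path_inv x j : 0 <= x < 1 ->
  tree_lo (tree_path x j) <= x < tree_lo (tree_path x j) + m (tree_path x j).
Proof.
move=> hx; elim: j => [|j IH] /=; first by rewrite /tree_lo big_ord0 add0r m_nil.
rewrite tree_lo_rcons; move: IH; set s := tree_path x j; rewrite (m_split s).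
by case: (leP (tree_lo s + m (rcons s false)) x) => h /andP[h1 h2]; apply/andP; split; lra.
Qed.

Lemma tree_path_gt0 x j : 0 <= x < 1 -> 0 < m (tree_path x j).
Proof. by move=> /(tree_path_inv j) /andP[h1 h2]; lra. Qed.

Lemma tree_lo_bounds s : 0 <= tree_lo s /\ tree_lo s + m s <= 1.
Proof.
elim/last_ind: s => [|s b [h1 h2]].
  by rewrite /tree_lo big_ord0 add0r m_nil.
have := m_split s; have := m_ge0 (rcons s false); have := m_ge0 (rcons s true).
by rewrite tree_lo_rcons; case: b => *; split; lra.
Qed.

Lemma tree_path_fiber s x : 0 <= x < 1 ->
  (tree_path x (size s) == s) = (tree_lo s <= x < tree_lo s + m s).
Proof.
move=> hx; apply/eqP/idP => [h|]; first by have := tree_path_inv (size s) hx; rewrite h.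
elim/last_ind: s => [//|s b IH]; rewrite size_rcons /= tree_lo_rcons => h.
have := m_split s; have := m_ge0 (rcons s false); have := m_ge0 (rcons s true) => a1 a2 a3.
have -> : tree_path x (size s) = s by apply: IH; case: b h => /andP[h1 h2]; apply/andP; split; lra.
by congr rcons; case: b h => /andP[h1 h2]; [rewrite h1|apply/negbTE; rewrite -ltNge; lra].
Qed.

Lemma tree_fiberE s : [set x | 0 <= x < 1 /\ tree_path x (size s) = s] =
  [set` `[tree_lo s, tree_lo s + m s[].
Proof.
have [h1 h2] := tree_lo_bounds s; apply/seteqP; split => x /=; rewrite in_itv /=.
  by move=> [hx /eqP]; rewrite tree_path_fiber.
move=> h; have hx : 0 <= x < 1 by lra.
by split => //; apply/eqP; rewrite tree_path_fiber.
Qed.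

Lemma measure_tree_fiber s :
  lebesgue_measure ([set x | 0 <= x < 1 /\ tree_path x (size s) = s] : set (measurableTypeR R))
  = (m s)%:E.
Proof.
rewrite tree_fiberE lebesgue_measure_itv /= lte_fin ltrDl.
have := m_ge0 s; rewrite le_eqVlt => /predU1P[<-|->]; first by rewrite ltxx.
by rewrite -EFinB addrC addKr.
Qed.

End Tree.

(** * Truncated logarithmic energy of greedy sequences *)

Section Greedy.
Variable R : realType.
Notation C := (R * R)%type.

(** For $T\ge0$ this is $\log(1/d)$ clipped to $[0,T]$, with value $T$ at $d=0$: a bounded Lipschitz
    version of the energy kernel. *)
Definition trunc_log (T d : R) : R := - ln (Num.min 1 (Num.max (expR (- T)) d)).

Lemma trunc_log_arg (T d : R) : 0 <= T ->
  expR (- T) <= Num.min 1 (Num.max (expR (- T)) d) <= 1.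
Proof.
move=> T0; rewrite le_min le_max lexx /= ge_min lexx andbT andbT.
by rewrite -expR0 ler_expR oppr_le0.
Qed.

Lemma trunc_log_ge0 (T d : R) : 0 <= T -> 0 <= trunc_log T d.
Proof.
by move=> /(trunc_log_arg d) /andP[_ h]; rewrite /trunc_log oppr_ge0 ln_le0.
Qed.

Lemma trunc_log0 (T : R) : 0 <= T -> trunc_log T 0 = T.
Proof.
move=> T0; rewrite /trunc_log; have e0 := expR_ge0 (- T).
rewrite (max_idPl e0) min_r ?expRK ?opprK //.
by rewrite -expR0 ler_expR oppr_le0.
Qed.

Lemma trunc_log_le (T d b : R) : 0 <= T -> 0 < d -> d <= b -> 1 <= b ->
  trunc_log T d <= ln b - ln d.
Proof.
move=> T0 d0 db b1; rewrite /trunc_log lerNl opprB lerBlDr.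
have b0 : 0 < b by lra.
have /andP[h1 h2] := trunc_log_arg d T0.
have p0 : 0 < Num.min 1 (Num.max (expR (- T)) d) by exact: lt_le_trans (expR_gt0 _) h1.
rewrite -lnM ?posrE // ler_ln ?posrE ?mulr_gt0 //.
have [d1|d1] := leP d 1.
  apply: (@le_trans _ _ (Num.min 1 (Num.max (expR (- T)) d))); last by rewrite ler_peMr // ltW.
  by rewrite le_min d1 le_max lexx orbT.
apply: (le_trans db); rewrite ler_peMl ?(ltW b0) // le_min lexx le_max.
by rewrite (ltW d1) orbT.
Qed.

Lemma trunc_log_lip (T d d' : R) : 0 <= T ->
  trunc_log T d <= trunc_log T d' + expR T * `|d - d'|.
Proof.
move=> T0; rewrite /trunc_log.
set x := Num.min 1 _; set y := Num.min 1 _.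
have /andP[x1 _] := trunc_log_arg d T0; have /andP[y1 _] := trunc_log_arg d' T0.
rewrite -/x in x1; rewrite -/y in y1.
have e0 := expR_gt0 (- T); have x0 : 0 < x by exact: lt_le_trans x1.
have y0 : 0 < y by exact: lt_le_trans y1.
have xy : y - x <= `|d - d'|.
  rewrite /x /y; have [? ?] : d' - d <= `|d - d'| /\ 0 <= `|d - d'|.
    by split => //; rewrite distrC ler_norm.
  by rewrite /Num.min /Num.max; repeat case: ifPn; rewrite -?leNgt => *; lra.
have : ln (y / x) <= y / x - 1.
  by rewrite -[X in ln X](subrKC 1) le_ln1Dx // ltrBrDl subrr divr_gt0.
rewrite ln_div ?posrE // => h.
have : y / x - 1 <= expR T * `|d - d'|.
  rewrite (_ : y / x - 1 = x^-1 * (y - x)); last by field; rewrite gt_eqF.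
  apply: (@le_trans _ _ (x^-1 * `|d - d'|)).
    by rewrite ler_pM2l ?invr_gt0.
  by apply: ler_wpM2r => //; rewrite -[expR T]invrK -expRN lef_pV2 ?posrE.
lra.
Qed.

Lemma ln_prod (I : Type) (s : seq I) (f : I -> R) : (forall i, 0 < f i) ->
  ln (\prod_(i <- s) f i) = \sum_(i <- s) ln (f i).
Proof.
move=> f0; elim: s => [|i s IH]; first by rewrite !big_nil ln1.
by rewrite !big_cons lnM ?posrE ?IH // prodr_gt0.
Qed.

(** Adding the point $w_n$ contributes two rows, each at most $(\log b+M)n$ by the product bound,
    and a diagonal term $T$. Hence the energy per pair stays bounded, with a truncation cost of only
    $T/n$. *)
Lemma greedy_energy (w : nat -> C) (M b T : R) :
  0 <= M -> 1 <= b -> 0 <= T -> (forall i j, cdist (w i) (w j) <= b) ->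
  (forall n, expR (- M * n%:R) <= \prod_(i < n) cdist (w n) (w i)) ->
  forall n, \sum_(i < n) \sum_(j < n) trunc_log T (cdist (w i) (w j))
     <= (ln b + M) * n%:R ^+ 2 + T * n%:R.
Proof.
move=> M0 b1 T0 wb hw.
have b0 : 0 <= ln b by exact: ln_ge0.
have row n : \sum_(i < n) trunc_log T (cdist (w n) (w i)) <= (ln b + M) * n%:R.
  have p0 (i : 'I_n) : 0 < cdist (w n) (w i).
    rewrite lt0r cdist_ge0 andbT; apply/eqP => h; have := hw n.
    by rewrite (bigD1 i) //= h mul0r leNgt expR_gt0.
  apply: (@le_trans _ _ (\sum_(i < n) (ln b - ln (cdist (w n) (w i))))).
    by apply: ler_sum => i _; exact: trunc_log_le.
  have hS : - (M * n%:R) <= \sum_(i < n) ln (cdist (w n) (w i)).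
    rewrite -ln_prod //.
    rewrite -mulNr -[X in X <= _]expRK ler_ln ?posrE ?expR_gt0 //.
    by apply: prodr_gt0 => i _.
  by rewrite sumrB sumr_const card_ord -[ln b *+ n]mulr_natr; lra.
elim=> [|n IH]; first by rewrite big_ord0 expr0n /= !mulr0 addr0.
rewrite big_ord_recr /=.
under eq_bigr do rewrite big_ord_recr /=.
rewrite big_split /= big_ord_recr /= cdist0 trunc_log0 //.
under [X in _ + X + _ <= _]eq_bigr do rewrite cdistC.
have := row n; rewrite -natr1 => h.
have : 0 <= (ln b + M) by lra.
move: (\sum_(i < n) trunc_log _ _) h => r h hA; nra.
Qed.

Lemma greedy_sequence (K : set C) (M : R) :
  (forall s : seq C, (forall q, q \in s -> K q) -> exists w, K w /\
     expR (- M * (size s)%:R) <= \prod_(q <- s) cdist w q) ->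
  exists w : nat -> C, (forall n, K (w n)) /\
    forall n, expR (- M * n%:R) <= \prod_(i < n) cdist (w n) (w i).
Proof.
move=> h.
(* The implication is moved under the existential so that [choice] applies to every sequence;
   outside $K$ the value $(0,0)$ is a dummy. *)
have h' (s : seq C) : exists w, (forall q, q \in s -> K q) -> K w /\
     expR (- M * (size s)%:R) <= \prod_(q <- s) cdist w q.
  have [hs|hs] := pselect (forall q, q \in s -> K q).
    by have [w hw] := h s hs; exists w.
  by exists (0, 0).
have [f hf] := choice h'.
pose L := fix L n := if n is n'.+1 then rcons (L n') (f (L n')) else [::].
have KL n : forall q, q \in L n -> K q.
  elim: n => // n IH q; rewrite /= mem_rcons inE => /predU1P[->|/IH //].
  by have [] := hf _ IH.
have sL n : size (L n) = n by elim: n => //= n IH; rewrite size_rcons IH.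
have LE n : L n = [seq f (L i) | i <- iota 0 n].
  by elim: n => // n IH; rewrite -addn1 iotaD map_cat -IH /= add0n cats1 addn1.
exists (fun n => f (L n)); split=> n; have [h1 h2] := hf _ (KL n) => //.
move: h2; rewrite sL; move: (f (L n)) => x; rewrite LE big_map.
by rewrite -[X in iota 0 X]subn0 -/(index_iota 0 n) big_mkord.
Qed.

End Greedy.

(** * Binary codes of points and limits of empirical measures *)

Section Coding.
Variable R : realType.
Notation C := (R * R)%type.
Implicit Types (K : set C) (b : C -> nat -> bool).

Definition code_fine K b (j : nat) (eta : R) := forall z z', K z -> K z' ->
  mkseq (b z) j = mkseq (b z') j -> cdist z z' <= eta.

Lemma take_mkseq (T : Type) (f : nat -> T) j k : (j <= k)%N ->
  take j (mkseq f k) = mkseq f j.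
Proof. by move=> jk; rewrite /mkseq -map_take take_iota (minn_idPl jk). Qed.

Lemma code_fineW K b j k eta : (j <= k)%N -> code_fine K b j eta -> code_fine K b k eta.
Proof.
move=> jk h z z' Kz Kz' E; apply: h => //.
by rewrite -(take_mkseq (b z) jk) -(take_mkseq (b z') jk) E.
Qed.

Lemma compact_accumulation K (z : nat -> C) : compact K -> (forall n, K (z n)) ->
  exists2 a : C, K a & forall (e : R) N, 0 < e -> exists2 n, (N <= n)%N & cdist a (z n) < e.
Proof.
move=> cK Kz; have [a [Ka ha]] : K `&` cluster (z n @[n --> \oo]) !=set0.
  by apply: cK; exists 0%N => // n _; exact: Kz.
exists a => // e N e0.
have [_ [[n /= Nn <-] hn]] := ha (z @` [set n | (N <= n)%N]) [set w | cdist a w < e]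
  ltac:(by exists N => // n Nn; exists n) (near_cdist a e0).
by exists n.
Qed.

(** Bit $i$ records membership in the $i$-th disc with rational data. If prefixes of every length
    failed to separate points $\eta$-apart, the bad pairs would accumulate at some $z\in K$. A small
    rational disc around $z$ then contains one point of a late pair, hence the other one too, since
    their bits agree. *)
Lemma code_exists K : compact K ->
  exists b, forall eta : R, 0 < eta -> exists j, code_fine K b j eta.
Proof.
move=> cK.
pose c (q : (rat * rat) * rat) : C := (ratr q.1.1, ratr q.1.2).
pose B (i : nat) : set C := if unpickle i is Some q then
  [set w | cdist w (c q) < ratr q.2] else set0.
pose rad (i : nat) : R := if @unpickle ((rat * rat) * rat)%type i is Some q then ratr q.2 else 0.
exists (fun w i => `[< B i w >]) => eta eta0.
have oB i z : B i z -> exists2 e : R, 0 < e & forall w, cdist z w < e -> B i w.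
  rewrite /B; case: unpickle => [q /= hz|//].
  exists (ratr q.2 - cdist z (c q)); first by rewrite subr_gt0.
  by move=> w hw; rewrite (le_lt_trans (cdist_triangle _ z _)) // (cdistC w) -ltrBrDr.
have smallB w : exists i, B i w /\ forall z z', B i z -> B i z' -> cdist z z' <= eta.
  have e8 : 0 < eta / 8 by rewrite divr_gt0.
  have [q1 /=] : exists q, ratr q \in `](w.1 - eta / 8), (w.1 + eta / 8)[%R.
    by apply: rat_in_itvoo; lra.
  rewrite in_itv /= => /andP[a1 a2].
  have [q2 /=] : exists q, ratr q \in `](w.2 - eta / 8), (w.2 + eta / 8)[%R.
    by apply: rat_in_itvoo; lra.
  rewrite in_itv /= => /andP[b1 b2].
  have [q3 /=] : exists q, ratr q \in `](eta / 4), (eta / 2)[%R.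
    by apply: rat_in_itvoo; lra.
  rewrite in_itv /= => /andP[d1 d2].
  exists (pickle ((q1, q2), q3)); rewrite /B pickleK /=; split.
    apply: (@le_lt_trans _ _ (2 * (eta / 8))); last lra.
    by apply: cdist_le; rewrite ?ltW //= ltr_norml; apply/andP; split; lra.
  move=> z z' h1 h2; rewrite (le_trans (cdist_triangle _ (c ((q1, q2), q3)) _)) //.
  by rewrite (cdistC (c _)); lra.
apply: contrapT => /forallNP hj.
have {}hj j : exists zz : C * C, [/\ K zz.1, K zz.2,
    mkseq (fun i => `[< B i zz.1 >]) j = mkseq (fun i => `[< B i zz.2 >]) j &
    eta < cdist zz.1 zz.2].
  apply: contrapT => /forallNP hn; apply: (hj j) => z z' Kz Kz' E.
  by rewrite leNgt; apply/negP => h; apply: (hn (z, z')).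
have [zz hzz] := choice hj.
have Kzz j : K (zz j).1 by have [] := hzz j.
have [z Kz hz] := compact_accumulation cK Kzz.
have [i [Bz dB]] := smallB z; have [e e0 he] := oB i z Bz.
have [j ij /he Bj] := hz e i.+1 e0; have [_ _ E] := hzz j.
rewrite ltNge => /negP; apply; apply: dB => //.
have := congr1 (fun s => nth false s i) E; rewrite !nth_mkseq // => h.
by apply/asboolP; rewrite -h; apply/asboolP.
Qed.

Section Limit.
Variables (K : set C) (b : C -> nat -> bool) (w : nat -> C).
Hypotheses (cK : compact K) (Kw : forall n, K (w n)).
Hypothesis bfine : forall eta : R, 0 < eta -> exists j, code_fine K b j eta.

(** The mass that the empirical measure of the first $n$ points gives to the codes beginning with
    [s]. *)
Definition emp (n : nat) (s : seq bool) : R :=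
  n%:R^-1 * \sum_(i < n) (mkseq (b (w i)) (size s) == s)%:R.

Lemma emp_ge0 n s : 0 <= emp n s.
Proof. by rewrite mulr_ge0 ?invr_ge0 // sumr_ge0. Qed.

Lemma emp_le1 n s : emp n s <= 1.
Proof.
rewrite /emp; case: n => [|n]; first by rewrite big_ord0 mulr0.
rewrite mulrC ler_pdivrMr // mul1r -[X in _ <= X%:R]card_ord -sumr_const.
by apply: ler_sum => i _; case: eqP.
Qed.

Lemma emp_nil n : (0 < n)%N -> emp n [::] = 1.
Proof.
move=> n0; rewrite /emp (eq_bigr (fun=> 1)) => [|i _]; last by rewrite eqxx.
by rewrite sumr_const card_ord mulVf // pnatr_eq0 -lt0n.
Qed.

Lemma emp_split n s : emp n s = emp n (rcons s false) + emp n (rcons s true).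
Proof.
rewrite /emp -mulrDr -big_split /=; congr (_ * _); apply: eq_bigr => i _.
rewrite !size_rcons /mkseq -addn1 iotaD map_cat /= add0n cats1 !eqseq_rcons.
by case: eqP => _; case: (b _ _); rewrite /= ?addr0 ?add0r.
Qed.

(** All frequencies lie in $[0,1]$, so a single ultrafilter finer than the tails makes them converge
    for all words at once, in place of a diagonal subsequence. *)
Lemma emp_limit : exists (U : set_system nat) (m : seq bool -> R),
  [/\ ProperFilter U, \oo `<=` U & forall s, emp n s @[n --> U] --> m s].
Proof.
have [U [uU hU]] := ultraFilterLemma (@eventually_filter).
have pU : ProperFilter U by exact: ultra_proper.
suff h s : exists x : R, emp n s @[n --> U] --> x.
  by have [m hm] := choice h; exists U, m; split.
have c01 : compact `[0, 1 : R] by exact: segment_compact.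
have [x [_ hx]] : `[0, 1] `&` cluster (emp n s @[n --> U]) !=set0.
  apply: c01; change (U [set n | emp n s \in `[0, 1]]).
  apply: (@filterS _ U _ setT); last exact: filterT.
  by move=> n _ /=; rewrite in_itv /= emp_ge0 emp_le1.
exists x; apply/cvgrPdist_lt => e e0.
have [//|h] := in_ultra_setVsetC [set n | `|x - emp n s| < e] uU.
have hA : (emp n s @[n --> U]) ((emp ^~ s) @` (~` [set n | `|x - emp n s| < e])).
  by apply: (@filterS _ U _ _ _ _ h) => n hn; exists n.
have [_ [[n hn <-] hb]] := hx _ _ hA (nbhsx_ballx x e e0).
by have := hn hb.
Qed.

End Limit.
End Coding.

(** * A probability space carrying a random infinite word *)

Section TreeSpace.
Variable R : realType.

Lemma tree_space (m : seq bool -> R) : m [::] = 1 -> (forall s, 0 <= m s) ->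
  (forall s, m s = m (rcons s false) + m (rcons s true)) ->
  exists d (T : measurableType d) (P : {finite_measure set T -> \bar R})
    (px : nat -> T -> seq bool),
  [/\ P setT = 1%E,
      (forall j x, size (px j x) = j),
      (forall j k x, (j <= k)%N -> take j (px k x) = px j x),
      (forall j x, 0 < m (px j x)) &
      (forall s, measurable [set x | px (size s) x = s] /\
         P [set x | px (size s) x = s] = (m s)%:E)].
Proof.
move=> m1 m0 ms; pose T := measurableTypeR R.
have mI : measurable (`[0%R, 1%R[%classic : set T) by exact: measurable_itv.
have lI : lebesgue_measure (`[0%R, 1%R[%classic : set T) = 1%E.
  by rewrite lebesgue_measure_itv /= lte_fin ltr01 oppr0 adde0.
have fI : (lebesgue_measure (`[0%R, 1%R[%classic : set T) < +oo)%E by rewrite lI ltry.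
(* Points outside $[0,1)$ are null but still need an address of positive weight. They are all sent
   to $0$, so each fibre contains either all or none of them, which settles its measurability
   there. *)
pose clip (x : T) : R := if 0 <= (x : R) < 1 then x else 0.
have hclip x : 0 <= clip x < 1 by rewrite /clip; case: ifPn => // _; rewrite lexx ltr01.
have fib s : [set x : T | tree_path m (clip x) (size s) = s] `&` `[0%R, 1%R[%classic =
   [set x : R | 0 <= x < 1 /\ tree_path m x (size s) = s].
  apply/seteqP; split => x /=; rewrite in_itv /= => -[h1 h2].
    by move: h1; rewrite /clip h2.
  by rewrite /clip h1; split.
have mfib s : measurable ([set x : T | tree_path m (clip x) (size s) = s] `&` `[0%R, 1%R[%classic).
  by rewrite fib tree_fiberE //; exact: measurable_itv.
exists _, T, (mfrestr mI fI), (fun j x => tree_path m (clip x) j); split.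
- by change (lebesgue_measure ([set: T] `&` `[0%R, 1%R[%classic) = 1%E); rewrite setTI.
- by move=> j x; rewrite size_tree_path.
- by move=> j k x; exact: take_tree_path.
- by move=> j x; exact: tree_path_gt0.
- move=> s; split; last first.
    change (lebesgue_measure ([set x : T | tree_path m (clip x) (size s) = s]
      `&` `[0%R, 1%R[%classic) = (m s)%:E).
    by rewrite fib measure_tree_fiber.
  pose B : set T := `[0%R, 1%R[%classic.
  rewrite -[X in measurable X]setIT -(setUv B) setIUr; apply: measurableU => //.
  have [h|h] := pselect (tree_path m 0 (size s) = s).
    rewrite (_ : _ `&` ~` B = ~` B); first exact: measurableC.
    apply/seteqP; split => x /=; first by case.
    move=> hx; split => //; move: hx; rewrite /B /= in_itv /= => /negP/negbTE hx.
    by rewrite /clip hx.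
  rewrite (_ : _ `&` ~` B = set0) //; apply/seteqP; split => x //= -[h1].
  by rewrite /B /= in_itv /= => /negP/negbTE hx; apply: h; rewrite /clip hx in h1.
Qed.

End TreeSpace.

(** * The decoding map into $K$ and its integrals *)

Section Representatives.
Variable R : realType.
Notation C := (R * R)%type.
Variables (K : set C) (b : C -> nat -> bool) (w : nat -> C).
Hypotheses (cK : compact K) (Kw : forall n, K (w n)).
Hypothesis bfine : forall eta : R, 0 < eta -> exists j, code_fine K b j eta.
Variables (U : set_system nat) (m : seq bool -> R).
Hypotheses (pU : ProperFilter U) (hU : \oo `<=` U).
Hypothesis hm : forall s, emp b w n s @[n --> U] --> m s.

Lemma emp_unique (f : nat -> R) (x y : R) :
  f n @[n --> U] --> x -> f n @[n --> U] --> y -> x = y.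
Proof.
move=> fx fy; have <- := cvg_lim (@Rhausdorff R) fx.
by have <- := cvg_lim (@Rhausdorff R) fy.
Qed.

Lemma emp_m_nil : m [::] = 1.
Proof.
have h : emp b w n [::] @[n --> U] --> (1 : R).
  apply: cvg_near_cst; apply: hU; exists 1%N => // n /= n1.
  by rewrite emp_nil.
exact: (emp_unique (@hm [::]) h).
Qed.

Lemma emp_m_ge0 s : 0 <= m s.
Proof.
have <- := cvg_lim (@Rhausdorff R) (@hm s).
apply: limr_ge; first by apply/cvg_ex; exists (m s); exact: hm.
by apply: nearW => n; exact: emp_ge0.
Qed.

Lemma emp_m_split s : m s = m (rcons s false) + m (rcons s true).
Proof.
have h : emp b w n s @[n --> U] --> m (rcons s false) + m (rcons s true).
  under eq_fun do rewrite emp_split.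
  by apply: cvgD; exact: hm.
exact: (emp_unique (@hm s) h).
Qed.

Definition rep (s : seq bool) : C := xget (w 0%N) [set z | K z /\ mkseq (b z) (size s) = s].

Lemma rep_in s : K (rep s).
Proof. by rewrite /rep; case: xgetP => [z _ []|_ ] //; exact: Kw. Qed.

Lemma rep_code z j : K z -> mkseq (b (rep (mkseq (b z) j))) j = mkseq (b z) j.
Proof.
move=> Kz; rewrite /rep; case: xgetP => [z' _ [_]|/(_ z)]; first by rewrite size_mkseq.
by case; rewrite /= size_mkseq.
Qed.

(** If no sampled point had code [s], every empirical weight of [s] would vanish and so would the
    limit. A positive weight therefore rules out the default value in [rep]. *)
Lemma rep_code_pos s : 0 < m s -> mkseq (b (rep s)) (size s) = s.
Proof.
move=> ms; have [i <-] : exists i, mkseq (b (w i)) (size s) = s.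
  apply: contrapT => /forallNP h.
  have h0 : emp b w n s @[n --> U] --> (0 : R).
    rewrite (_ : (fun n => _) = (fun=> 0)); first exact: cvg_cst.
    apply/funext => n; rewrite /emp big1 ?mulr0 // => i _.
    by case: eqP => // /h.
  by move: ms; rewrite (emp_unique (@hm s) h0) ltxx.
by rewrite size_mkseq rep_code.
Qed.

Variables (d : measure_display) (T : measurableType d) (px : nat -> T -> seq bool).
Hypotheses (px_size : forall j x, size (px j x) = j)
  (px_take : forall j k x, (j <= k)%N -> take j (px k x) = px j x)
  (px_pos : forall j x, 0 < m (px j x)).

Lemma rep_px j x : mkseq (b (rep (px j x))) j = px j x.
Proof. by have := rep_code_pos (px_pos j x); rewrite px_size. Qed.

(** The decoded point is an accumulation point of representatives of longer and longer prefixes;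
    later representatives share the earlier prefixes, so the closeness bound survives in the
    limit. *)
Lemma limit_map : exists phi : T -> C, forall x, K (phi x) /\
  forall j eta, code_fine K b j eta -> cdist (phi x) (rep (px j x)) <= eta.
Proof.
suff h x : exists z, K z /\
    forall j eta, code_fine K b j eta -> cdist z (rep (px j x)) <= eta.
  by have [phi hphi] := choice h; exists phi.
have [z Kz hz] := compact_accumulation cK (fun n => rep_in (px n x)).
exists z; split => // j eta hj; apply/ler_addgt0Pl => e e0.
have [n jn hn] := hz e j e0.
apply: (le_trans (cdist_triangle _ (rep (px n x)) _)).
apply: lerD; first exact: ltW.
apply: hj; [exact: rep_in|exact: rep_in|].
by rewrite -(take_mkseq _ jn) !rep_px px_take.
Qed.

Hypothesis px_meas : forall s, measurable [set x | px (size s) x = s].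

Lemma px_sumE (F : seq bool -> R) j x :
  F (px j x) = \sum_(t : j.-tuple bool) F t * \1_[set x | px j x = t] x.
Proof.
pose t0 : j.-tuple bool := Tuple (introT eqP (px_size j x)).
rewrite (bigD1 t0) //= indicE mem_set // mulr1 big1 ?addr0 // => t tt0.
rewrite indicE memNset ?mulr0 //= => E; move/eqP: tt0; apply.
by apply: val_inj; rewrite /= E.
Qed.

Lemma px_meas_tuple j (t : j.-tuple bool) : measurable [set x | px j x = t].
Proof. by have := px_meas t; rewrite size_tuple. Qed.

Lemma px_measurable (F : seq bool -> R) j : measurable_fun setT (fun x => F (px j x)).
Proof.
rewrite (_ : (fun x => _) = (fun x => \sum_(t : j.-tuple bool) F t * \1_[set x | px j x = t] x)).
  apply: measurable_sum => t; apply: measurable_funM => //.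
  by apply: measurable_indic; exact: px_meas_tuple.
by apply/funext => x; exact: px_sumE.
Qed.

(** The decoding map is the pointwise limit of $x\mapsto$ [rep (px j x)], and each of these depends
    on finitely many measurable fibres. *)
Lemma limit_map_measurable (phi : T -> C) :
  (forall x, K (phi x) /\
    forall j eta, code_fine K b j eta -> cdist (phi x) (rep (px j x)) <= eta) ->
  measurable_fun setT phi.
Proof.
move=> hphi.
have cv x (e : R) : 0 < e -> \forall j \near \oo, cdist (phi x) (rep (px j x)) < e.
  move=> e0; have [j hj] := bfine (divr_gt0 e0 (@ltr0n R 2)).
  exists j => // k /= jk; apply: (@le_lt_trans _ _ (e / 2)); last lra.
  by apply: (hphi x).2; exact: code_fineW hj.
rewrite (_ : phi = (fun x => ((phi x).1, (phi x).2))); last first.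
  by apply/funext => x; exact: surjective_pairing.
apply: measurable_fun_pair.
- apply: (@measurable_fun_cvg _ _ _ _ (fun j x => (rep (px j x)).1)).
    by move=> j; exact: (px_measurable (fun s => (rep s).1)).
  move=> x _; apply/cvgrPdist_lt => e e0; apply: filterS (cv x e e0) => j.
  exact: le_lt_trans (cdist_fst _ _).
- apply: (@measurable_fun_cvg _ _ _ _ (fun j x => (rep (px j x)).2)).
    by move=> j; exact: (px_measurable (fun s => (rep s).2)).
  move=> x _; apply/cvgrPdist_lt => e e0; apply: filterS (cv x e e0) => j.
  exact: le_lt_trans (cdist_snd _ _).
Qed.

Variable P : {finite_measure set T -> \bar R}.
Hypothesis px_mass : forall s, P [set x | px (size s) x = s] = (m s)%:E.

Lemma px_integral (F : seq bool -> R) j : (forall s, 0 <= F s) ->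
  (\int[P]_x (F (px j x))%:E = (\sum_(t : j.-tuple bool) F t * m t)%:E)%E.
Proof.
move=> F0.
under eq_integral do rewrite px_sumE -sumEFin.
rewrite ge0_integral_sum //; first last.
- by move=> t x _; rewrite lee_fin mulr_ge0.
- move=> t; apply/measurable_EFinP; apply: measurable_funM => //.
  by apply: measurable_indic; exact: px_meas_tuple.
rewrite -sumEFin; apply: eq_bigr => t _.
under eq_integral do rewrite EFinM.
rewrite ge0_integralZl //; last by rewrite lee_fin.
  rewrite integral_indic ?setIT //; last exact: px_meas_tuple.
  rewrite EFinM; congr (_ * _)%E.
  by have := px_mass t; rewrite size_tuple.
by apply/measurable_EFinP; apply: measurable_indic; exact: px_meas_tuple.
Qed.

Lemma emp_double_sum (H : seq bool -> seq bool -> R) j n :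
  \sum_(s : j.-tuple bool) (\sum_(t : j.-tuple bool) H s t * emp b w n t) * emp b w n s =
  n%:R^-1 ^+ 2 * \sum_(i < n) \sum_(k < n) H (mkseq (b (w i)) j) (mkseq (b (w k)) j).
Proof.
have one (F : seq bool -> R) :
    \sum_(t : j.-tuple bool) F t * emp b w n t = n%:R^-1 * \sum_(i < n) F (mkseq (b (w i)) j).
  under eq_bigr do rewrite /emp mulrCA mulr_sumr.
  rewrite -mulr_sumr; congr (_ * _); rewrite exchange_big /=; apply: eq_bigr => i _.
  have sz : size (mkseq (b (w i)) j) == j by rewrite size_mkseq.
  rewrite (bigD1 (Tuple sz)) //= size_mkseq eqxx mulr1 big1 ?addr0 // => t tn.
  rewrite size_tuple; case: eqP => [E|]; last by rewrite mulr0.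
  by move/eqP: tn; case; apply: val_inj; rewrite /= E.
rewrite (one (fun s => \sum_(t : j.-tuple bool) H s t * emp b w n t)).
under eq_bigr do rewrite one.
by rewrite -mulr_sumr expr2 mulrA.
Qed.

(** At a fixed depth the double sum is a polynomial in finitely many weights, so an eventual bound
    on empirical energies passes to the limit along [U]. *)
Lemma limit_double_sum (H : seq bool -> seq bool -> R) j (A : R) :
  (\forall n \near \oo, n%:R^-1 ^+ 2 *
     \sum_(i < n) \sum_(k < n) H (mkseq (b (w i)) j) (mkseq (b (w k)) j) <= A) ->
  \sum_(s : j.-tuple bool) (\sum_(t : j.-tuple bool) H s t * m t) * m s <= A.
Proof.
move=> hA.
have cv : (\sum_(s : j.-tuple bool) (\sum_(t : j.-tuple bool) H s t * emp b w n t) * emp b w n s)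
    @[n --> U] --> \sum_(s : j.-tuple bool) (\sum_(t : j.-tuple bool) H s t * m t) * m s.
  apply: cvg_big => [|s _]; first exact: add_continuous.
  apply: cvgM; last exact: hm.
  apply: cvg_big => [|t _]; first exact: add_continuous.
  apply: cvgM; last exact: hm.
  exact: cvg_cst.
have <- := cvg_lim (@Rhausdorff R) cv.
apply: limr_le; first by apply/cvg_ex; eexists; exact: cv.
by apply: hU; apply: filterS hA => n; rewrite emp_double_sum.
Qed.

End Representatives.

(** * Pushforward measures and lower bounds on energy *)

Section Pushforward.
Import HBNNSimple.
Context d1 d2 (T1 : measurableType d1) (T2 : measurableType d2) (R : realType).
Variables (P : {measure set T1 -> \bar R}) (phi : T1 -> T2).
Hypothesis mphi : measurable_fun setT phi.

(* Holds with equality for measurable [J]; the supremum over simple functions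
   gives this inequality with no measurability assumption. *)
Lemma integral_pushforward_le (J : T2 -> \bar R) : (forall z, (0 <= J z)%E) ->
  (\int[pushforward P phi]_z J z <= \int[P]_x J (phi x))%E.
Proof.
move=> J0; rewrite (ge0_integralTE (pushforward P phi) J0).
apply: ge_ereal_sup => _ [h /= hJ <-].
rewrite -(integralT_nnsfun (pushforward P phi) h) ge0_integral_pushforward //.
- by rewrite preimage_setT; apply: integral_mono => x _; exact: hJ.
- by apply/measurable_EFinP; exact: measurable_funPT.
- by move=> z _; rewrite lee_fin.
Qed.

Lemma pushforward_measure : exists mu : {measure set T2 -> \bar R},
  mu = pushforward P phi :> (set T2 -> \bar R).
Proof. by unshelve eexists (pushforward P phi : {measure set T2 -> \bar R}); first exact: mphi. Qed.

End Pushforward.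

Section Energy.
Variable R : realType.
Notation C := (R * R)%type.

Lemma trunc_log_homo (d S T : R) : S <= T -> trunc_log S d <= trunc_log T d.
Proof.
move=> ST; rewrite /trunc_log lerN2.
have e0 (X : R) : 0 < Num.min 1 (Num.max (expR (- X)) d).
  by rewrite lt_min ltr01 lt_max expR_gt0.
rewrite ler_ln ?posrE //.
have : expR (- T) <= expR (- S) by rewrite ler_expR lerN2.
by rewrite /Num.min /Num.max; repeat case: ifPn; rewrite -?leNgt => *; lra.
Qed.

Lemma measurable_trunc_log (T : R) : measurable_fun setT (trunc_log T).
Proof.
apply: measurableT_comp => //; apply: measurableT_comp; first exact: measurable_ln.
by apply: measurable_minr => //; exact: measurable_maxr.
Qed.

Lemma measurable_cdist d (T : measurableType d) (f g : T -> C) :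
  measurable_fun setT f -> measurable_fun setT g ->
  measurable_fun setT (fun x => cdist (f x) (g x)).
Proof.
move=> /measurable_fun_pairP [f1 f2] /measurable_fun_pairP [g1 g2].
apply: (@measurableT_comp _ _ _ _ _ _ (@Num.sqrt R)).
  by apply: continuous_measurable_fun; exact: sqrt_continuous.
by apply: measurable_funD; apply: measurable_funX; exact: measurable_funB.
Qed.

Lemma loge_neg_le_lim (d : R) : 0 <= d ->
  (maxe (- loge d) 0 <= limn (fun n => (trunc_log n%:R d)%:E))%E.
Proof.
move=> d0.
have hom : {homo (fun n => (trunc_log n%:R d)%:E) : n m / (n <= m)%N >-> (n <= m)%E}.
  by move=> n m nm; rewrite lee_fin trunc_log_homo // ler_nat.
have le_lim n : ((trunc_log n%:R d)%:E <= limn (fun n => (trunc_log n%:R d)%:E))%E.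
  rewrite (cvg_lim (@ereal_hausdorff R) (ereal_nondecreasing_cvgn hom)).
  by apply: ereal_sup_ubound; exists n.
rewrite ge_max; apply/andP; split; last first.
  by apply: le_trans (le_lim 0%N); rewrite lee_fin trunc_log_ge0.
rewrite /loge; case: eqVneq => [dz|dz].
  rewrite /= leye_eq; apply/eqP/eqyP => A A0.
  apply: le_trans (le_lim (Num.trunc A).+1); rewrite dz trunc_log0 // lee_fin.
  by rewrite ltW // truncnS_gt.
have dp : 0 < d by rewrite lt0r dz.
apply: le_trans (le_lim (Num.trunc (- ln d)).+1); rewrite lee_fin /trunc_log lerN2.
rewrite ler_ln ?posrE //; last by rewrite lt_min ltr01 lt_max expR_gt0.
rewrite ge_min ge_max lexx andbT; apply/orP; right.
by rewrite -[X in _ <= X](lnK dp) ler_expR lerNl ltW // truncnS_gt.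
Qed.

(** Only the negative part of the potential matters. It is dominated, after pulling back to [P], by
    the increasing limit of truncated kernels, and two uses of monotone convergence carry the
    uniform bound [A] to that limit. *)
Lemma energy_pushforward_gtNy d (T : measurableType d) (P : {finite_measure set T -> \bar R})
    (phi : T -> C) (mu : {measure set C -> \bar R}) (A : R) : measurable_fun setT phi ->
  mu = pushforward P phi :> (set C -> \bar R) ->
  (forall n, (\int[P]_x \int[P]_y (trunc_log n%:R (cdist (phi x) (phi y)))%:E <= A%:E)%E) ->
  (-oo < energy mu)%E.
Proof.
move=> mphi Emu hA.
have push (J : C -> \bar R) : (forall z, (0 <= J z)%E) ->
    (\int[mu]_z J z <= \int[P]_x J (phi x))%E.
  by rewrite Emu; exact: integral_pushforward_le.
pose inner z := (\int[mu]_w loge (cdist z w))%E.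
have h1 z : (inner^\-%E z <= \int[mu]_w maxe (- loge (cdist z w)) 0)%E.
  rewrite funenegE ge_max; apply/andP; split; last first.
    by apply: integral_ge0 => w _; rewrite le_max lexx orbT.
  rewrite /inner integralE.
  have p0 : (0 <= \int[mu]_w ((fun w => loge (cdist z w))^\+)%E w)%E.
    exact: integral_ge0.
  have -> : (\int[mu]_w maxe (- loge (cdist z w)) 0 =
      \int[mu]_w ((fun w => loge (cdist z w))^\-)%E w)%E.
    by apply: eq_integral => w _; rewrite funenegE.
  have n0 : (0 <= \int[mu]_w ((fun w => loge (cdist z w))^\-)%E w)%E.
    exact: integral_ge0.
  move: p0 n0; move: (integral _ _ _) => a; move: (integral _ _ _) => c.
  case: a => [a| |] //; case: c => [c| |] //=; rewrite ?leey ?leNye ?lee_fin // => a0 c0.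
  lra.
pose k n (xy : T * T) : \bar R := (trunc_log n%:R (cdist (phi xy.1) (phi xy.2)))%:E.
have mk n : measurable_fun setT (k n).
  apply/measurable_EFinP; apply: measurableT_comp; first exact: measurable_trunc_log.
  by apply: measurable_cdist; apply: measurableT_comp.
have k0 n xy : (0 <= k n xy)%E by rewrite lee_fin trunc_log_ge0.
have khom xy : {homo (fun n => k n xy) : n m / (n <= m)%N >-> (n <= m)%E}.
  by move=> n m nm; rewrite lee_fin trunc_log_homo // ler_nat.
have mk2 n x : measurable_fun setT (fun y => k n (x, y)).
  exact: measurable_fun_pair2.
have mI n : measurable_fun setT (fun x => \int[P]_y k n (x, y))%E.
  exact: (measurable_fun_fubini_tonelli_F (k n)).
have main : (\int[mu]_z inner^\-%E z <= A%:E)%E.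
  apply: (le_trans (push _ _)); first by move=> z; exact: funeneg_ge0.
  apply: (@le_trans _ _ (\int[P]_x \int[P]_y limn (fun n => k n (x, y)))%E).
    apply: integral_mono => x _; apply: (le_trans (h1 (phi x))).
    apply: (le_trans (push _ _)).
      by move=> w; rewrite le_max lexx orbT.
    by apply: integral_mono => y _; apply: loge_neg_le_lim; exact: cdist_ge0.
  rewrite (_ : (fun x => _) = (fun x => limn (fun n => \int[P]_y k n (x, y)))%E); last first.
    by apply/funext => x; rewrite (monotone_convergence P measurableT).
  rewrite (monotone_convergence P measurableT) //; first last.
  - by move=> x _ n l nl; apply: integral_mono => y _; exact: khom.
  - by move=> n x _; exact: integral_ge0.
  apply: lime_le; last by apply: nearW => n; exact: hA.
  apply: ereal_nondecreasing_is_cvgn => n l nl.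
  by apply: integral_mono => x _; apply: integral_mono => y _; exact: khom.
rewrite /energy integralE.
have p0 : (0 <= \int[mu]_z (inner^\+)%E z)%E by exact: integral_ge0.
move: p0 main; rewrite /inner; move: (integral _ _ _) => a; move: (integral _ _ _) => c.
by case: a => [a| |] //; case: c => [c| |] //=; rewrite ?leey // => *; exact: ltNyr.
Qed.

End Energy.

(** * Polynomials that are exponentially small on a polar compact set *)

Section PolarPoly.
Variable R : realType.
Notation C := (R * R)%type.

Lemma no_greedy_sequence (K : set C) (w : nat -> C) (M : R) : compact K -> polar K ->
  0 <= M -> (forall n, K (w n)) ->
  (forall n, expR (- M * n%:R) <= \prod_(i < n) cdist (w n) (w i)) -> False.
Proof.
move=> cK pK M0 Kw hw.
have [b1 b10 hb1] := compactC_bounded (w 0%N) cK.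
pose b : R := 1 + 2 * b1.
have wb i j : cdist (w i) (w j) <= b.
  apply: (le_trans (cdist_triangle _ (w 0%N) _)).
  have := hb1 _ (Kw i); have := hb1 _ (Kw j); rewrite (cdistC (w 0%N)) /b; lra.
have hen T (T0 : 0 <= T) := greedy_energy M0 (ltac:(rewrite /b; lra) : 1 <= b) T0 wb hw.
set A := ln b + M in hen.
have [code hcode] := code_exists cK.
have [U [m [pU hU hm]]] := emp_limit code w.
have m1 := emp_m_nil pU hU hm; have m0 := emp_m_ge0 pU hm.
have msp := emp_m_split pU hm.
have [d [T [P [px [P1 px1 px2 px3 px4]]]]] := tree_space m1 m0 msp.
have px_meas s := (px4 s).1; have px_mass s := (px4 s).2.
have [phi hphi] := limit_map cK Kw pU hm px1 px2 px3.
have mphi := limit_map_measurable hcode px1 px_meas hphi.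
have [mu Emu] := pushforward_measure P mphi.
have K_phi : mu (~` K) = 0%E.
  rewrite Emu /pushforward (_ : phi @^-1` (~` K) = set0) ?measure0 //.
  by apply/seteqP; split => x //= h; apply: h; exact: (hphi x).1.
have mu1 : mu setT = 1%E by rewrite Emu /pushforward preimage_setT.
have Emu_oo : energy mu = -oo%E.
  apply: pK; [by rewrite mu1 ltry|by rewrite mu1 oner_neq0|by exists K; first split].
suff : (-oo < energy mu)%E by rewrite Emu_oo.
(* Of the $3$, one unit pays for replacing decoded points by representatives, one for replacing
   these by sampled points, and one for the diagonal, as $nN\le N^2$ once $N>n$. *)
apply: (@energy_pushforward_gtNy _ _ _ P phi mu (A + 3)) => // n.
have n0 : 0 <= n%:R :> R by [].
(* The kernel truncated at $n$ is $e^n$-Lipschitz, so moving both points by at most $e^{-n}/2$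
   changes it by at most $1$. *)
have eta0 : 0 < expR (- n%:R) / 2 :> R by rewrite divr_gt0 ?expR_gt0.
have [j hj] := hcode _ eta0.
pose H (s t : seq bool) : R := trunc_log n%:R (cdist (rep K code w s) (rep K code w t)) + 1.
have H0 s t : 0 <= H s t by rewrite addr_ge0 // trunc_log_ge0.
have close (x x' y y' : C) : cdist x x' <= expR (- n%:R) / 2 ->
    cdist y y' <= expR (- n%:R) / 2 ->
    trunc_log n%:R (cdist x y) <= trunc_log n%:R (cdist x' y') + 1.
  move=> h1 h2; apply: (le_trans (trunc_log_lip _ (cdist x' y') n0)); rewrite lerD2l.
  have hd : `|cdist x y - cdist x' y'| <= expR (- n%:R).
    have h3 := cdist_lip x x' y; have h4 := cdist_lip y y' x'.
    rewrite (cdistC y) (cdistC y') in h4.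
    apply: (le_trans (ler_distD (cdist x' y) _ _)); lra.
  apply: (@le_trans _ _ (expR n%:R * expR (- n%:R))).
    by rewrite ler_pM2l ?expR_gt0.
  by rewrite -expRD subrr expR0.
have step x y : trunc_log n%:R (cdist (phi x) (phi y)) <= H (px j x) (px j y).
  by apply: close; [exact: (hphi x).2|exact: (hphi y).2].
have stepw i k : H (mkseq (code (w i)) j) (mkseq (code (w k)) j) <=
    trunc_log n%:R (cdist (w i) (w k)) + 1 + 1.
  rewrite lerD2r; apply: close.
  - by apply: hj; [exact: rep_in|exact: Kw|exact: rep_code].
  - by apply: hj; [exact: rep_in|exact: Kw|exact: rep_code].
apply: (@le_trans _ _ (\int[P]_x (\sum_(t : j.-tuple bool) H (px j x) t * m t)%:E)%E).
  apply: integral_mono => x _; rewrite -(px_integral px1 px_meas px_mass) //.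
  by apply: integral_mono => y _; rewrite lee_fin.
rewrite (px_integral px1 px_meas px_mass (F := fun s => \sum_(t : j.-tuple bool) H s t * m t)).
  rewrite lee_fin; apply: (limit_double_sum pU hU hm).
  exists n.+1 => // N /= nN.
  have N0 : 0 < N%:R :> R by rewrite ltr0n; exact: leq_trans nN.
  rewrite exprVn mulrC ler_pdivrMr ?exprn_gt0 //.
  apply: (@le_trans _ _ (\sum_(i < N) \sum_(k < N) (trunc_log n%:R (cdist (w i) (w k)) + 1 + 1))).
    by apply: ler_sum => i _; apply: ler_sum => k _; exact: stepw.
  under eq_bigr do rewrite big_split big_split /= sumr_const card_ord.
  rewrite big_split big_split /= !sumr_const card_ord.
  have := hen _ n0 N; move: (\sum_(i < N) _) => S hS.
  have nN' : n%:R <= N%:R :> R by rewrite ler_nat ltnW.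
  rewrite -[N%:R *+ N]mulr_natr; nra.
by move=> s; apply: sumr_ge0 => t _; rewrite mulr_ge0.
Qed.

Lemma polar_poly (K : set C) (M : R) : compact K -> K !=set0 -> polar K ->
  exists s : seq C, [/\ s != [::], forall q, q \in s -> K q &
    forall w, K w -> \prod_(q <- s) cdist w q < expR (- M * (size s)%:R)].
Proof.
move=> cK [w0 Kw0] pK; apply: contrapT => /forallNP hn.
pose M' := Num.max M 0.
have M'0 : 0 <= M' by rewrite le_max lexx orbT.
have [|w [Kw hw]] := @greedy_sequence R K M'; last exact: no_greedy_sequence M'0 Kw hw.
move=> s Ks; have [->|s0] := eqVneq s [::].
  by exists w0; rewrite big_nil mulr0 expR0; split.
have [w [Kw hw]] : exists w, K w /\ expR (- M * (size s)%:R) <= \prod_(q <- s) cdist w q.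
  apply: contrapT => /forallNP h; apply: (hn s); split => // w Kw.
  by rewrite ltNge; apply/negP => h'; apply: (h w).
exists w; split => //; apply: le_trans hw.
by rewrite ler_expR ler_wpM2r // lerN2 le_max lexx.
Qed.

End PolarPoly.

(** * Covering a set of small measure by short intervals *)

Section Cover.
Variable R : realType.

Lemma lebesgue_cover (L : set (measurableTypeR R)) (l : R) : (lebesgue_measure L < l%:E)%E ->
  exists c lam : nat -> R, [/\ forall k, 0 <= lam k,
    forall t, L t -> exists k, 0 < lam k /\ `|t - c k| <= lam k &
    (\sum_(0 <= k <oo) (lam k)%:E < l%:E)%E].
Proof.
move=> /ereal_inf_lt [_ /= [F [mF LF] <-] hF].
have mF' k : exists p : R * R, `]p.1, p.2]%classic = F k by have [p _ <-] := mF k; exists p.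
have [ab hab] := choice mF'.
pose lam k : R := Num.max 0 ((ab k).2 - (ab k).1).
have lamE k : wlength idfun (F k) = (lam k)%:E.
  rewrite -hab wlength_itv /= lte_fin /lam.
  by case: ltP => h; rewrite ?EFinB; [rewrite max_r // subr_ge0 ltW|rewrite max_l // subr_le0].
(* Each interval is centred at its right end with radius its full length; empty intervals get radius
   $0$ and cover nothing. *)
exists (fun k => (ab k).2), lam; split.
- by move=> k; rewrite le_max lexx.
- move=> t /LF [k _]; rewrite -hab /= in_itv /= => /andP[h1 h2].
  exists k; have -> : lam k = (ab k).2 - (ab k).1 by rewrite /lam max_r //; lra.
  by rewrite distrC ger0_norm; [split; lra|lra].
- by move: hF; rewrite (eq_eseriesr (fun k _ => lamE k)).
Qed.

End Cover.

(** * Positive harmonic functions concentrated near an arc *)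

Section Dipole.
Variable R : realType.
Notation C := (R * R)%type.
Implicit Types (z zeta : C) (rho lam c t : R).

Lemma cos_sin_lip (x y : R) : `|cos x - cos y| <= `|x - y| /\ `|sin x - sin y| <= `|x - y|.
Proof.
have lip (f df : R -> R) (a b : R) : (forall x : R, is_derive x 1 f (df x)) ->
    (forall x : R, `|df x| <= 1) -> `|f a - f b| <= `|a - b|.
  move=> hf hdf; wlog ab : a b / b < a.
    move=> W; have [h|h|->] := ltgtP a b; last by rewrite !subrr.
    - by rewrite distrC (distrC a); exact: W.
    - exact: W.
  have cf : {within `[b, a], continuous f}.
    by apply: derivable_within_continuous => u _; apply: ex_derive.
  have [u _ ->] := MVT ab (fun u _ => hf u) cf.
  by rewrite normrM ler_piMl.
have s1 u : `|- sin u| <= 1 :> R by rewrite normrN ler_norml sin_geN1 sin_le1.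
have c1 u : `|cos u| <= 1 :> R by rewrite ler_norml cos_geN1 cos_le1.
split; first exact: (lip cos (fun u => - sin u) x y (fun u => is_derive_cos u) s1).
exact: (lip sin cos x y (fun u => is_derive_sin u) c1).
Qed.

Lemma circ_lip zeta rho t c : 0 <= rho ->
  cdist (circ zeta rho t) (circ zeta rho c) <= 2 * (rho * `|t - c|).
Proof.
move=> r0; have [h1 h2] := cos_sin_lip t c.
apply: cdist_le; rewrite ?mulr_ge0 // /circ /= opprD addrACA subrr add0r -mulrBr.
  by rewrite normrM (ger0_norm r0) ler_wpM2l.
by rewrite normrM (ger0_norm r0) ler_wpM2l.
Qed.

Lemma circ_radial zeta (s s' c : R) : s <= s' ->
  cdist (circ zeta s c) (circ zeta s' c) = s' - s.
Proof.
move=> ss; rewrite /cdist /circ /=.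
rewrite (_ : _ + _ = (s' - s) ^+ 2 * (cos c ^+ 2 + sin c ^+ 2)); last by ring.
by rewrite cos2Dsin2 mulr1 sqrtr_sqr ger0_norm // subr_ge0.
Qed.

(** Both poles lie outside the disc of radius [rho], on the ray of angle [c]. The dipole replaces
    the harmonic measure of an arc of length comparable to [lam]: it is positive in the disc,
    bounded below near the arc, and of order [lam] near the centre. *)
Definition dipole zeta rho lam c z : R :=
  ln (cdist z (circ zeta (rho + 2 * lam) c)) - ln (cdist z (circ zeta (rho + lam) c)).

Section DipoleFacts.
Variables (zeta : C) (rho lam c : R).
Hypotheses (rho0 : 0 < rho) (lam0 : 0 <= lam).

Lemma pole_dist_ge z (s : R) : 0 <= s -> s - cdist zeta z <= cdist z (circ zeta s c).
Proof.
move=> s0; have := cdist_triangle zeta z (circ zeta s c).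
by rewrite circE_dist //; lra.
Qed.

Lemma pole_dist_gt0 z (s : R) : cdist zeta z < rho -> rho <= s ->
  0 < cdist z (circ zeta s c).
Proof.
move=> hz hs; have s0 : 0 <= s by apply: le_trans hs; exact: ltW.
by have := @pole_dist_ge z s s0; lra.
Qed.

(** Let $q$ be the component of $z-\zeta$ along the ray, so $q\le\rho$. The two squared distances
    differ by $2\lambda(\rho-q)+3\lambda^2$. *)
Lemma pole_dist_gap z : cdist zeta z < rho ->
  cdist z (circ zeta (rho + lam) c) ^+ 2 + 3 * lam ^+ 2 <=
  cdist z (circ zeta (rho + 2 * lam) c) ^+ 2.
Proof.
move=> hz; set p1 := z.1 - zeta.1; set p2 := z.2 - zeta.2.
have E s : cdist z (circ zeta s c) ^+ 2 =
    p1 ^+ 2 + p2 ^+ 2 - 2 * s * (p1 * cos c + p2 * sin c) + s ^+ 2.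
  rewrite cdist_sq /circ /= /p1 /p2.
  have cs := cos2Dsin2 c.
  transitivity ((z.1 - zeta.1) ^+ 2 + (z.2 - zeta.2) ^+ 2 -
    2 * s * ((z.1 - zeta.1) * cos c + (z.2 - zeta.2) * sin c) + s ^+ 2 * (cos c ^+ 2 + sin c ^+ 2)).
    by ring.
  by rewrite cs mulr1.
have hp : p1 * cos c + p2 * sin c <= rho.
  have h2 : p1 ^+ 2 + p2 ^+ 2 <= rho ^+ 2.
    have -> : p1 ^+ 2 + p2 ^+ 2 = cdist zeta z ^+ 2 by rewrite cdist_sq /p1 /p2; ring.
    by rewrite ler_pXn2r ?nnegrE ?cdist_ge0 ?(ltW rho0) // ltW.
  apply: (le_trans (ler_norm _)).
  rewrite -(@ler_pXn2r _ 2) ?nnegrE ?(ltW rho0) // real_normK ?num_real //.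
  have cs := cos2Dsin2 c.
  have := sqr_ge0 (p1 * sin c - p2 * cos c).
  have -> : (p1 * sin c - p2 * cos c) ^+ 2 =
    (p1 ^+ 2 + p2 ^+ 2) * (cos c ^+ 2 + sin c ^+ 2) - (p1 * cos c + p2 * sin c) ^+ 2 by ring.
  by rewrite cs mulr1 subr_ge0 => h; exact: le_trans h h2.
rewrite !E; move: (p1 * cos c + p2 * sin c) hp => q hp.
have := mulr_ge0 lam0 (_ : 0 <= rho - q); rewrite subr_ge0 => /(_ hp); lra.
Qed.

Lemma dipole_harmonic (U : set C) : (forall z, U z -> cdist zeta z < rho) ->
  mean_harmonic U (dipole zeta rho lam c).
Proof.
move=> hU.
have hs s : rho <= s -> mean_harmonic U (fun z => ln (cdist z (circ zeta s c))).
  move=> rs; apply: mean_harmonic_ln => /hU; rewrite circE_dist; first by rewrite ltNge rs.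
  by apply: le_trans rs; exact: ltW.
rewrite (_ : dipole zeta rho lam c = fun z =>
   1 * ln (cdist z (circ zeta (rho + 2 * lam) c)) + (-1) * ln (cdist z (circ zeta (rho + lam) c))).
  by apply: mean_harmonic_lin; apply: hs; rewrite lerDl ?mulr_ge0.
by apply/funext => z; rewrite mul1r mulN1r.
Qed.

Lemma dipole_ge0 z : cdist zeta z < rho -> 0 <= dipole zeta rho lam c z.
Proof.
move=> hz; rewrite subr_ge0.
have d1 : 0 < cdist z (circ zeta (rho + lam) c) by apply: pole_dist_gt0; rewrite // lerDl ?mulr_ge0.
have d2 : 0 < cdist z (circ zeta (rho + 2 * lam) c) by apply: pole_dist_gt0; rewrite // lerDl ?mulr_ge0.
rewrite ler_ln ?posrE // -(@ler_pXn2r _ 2) ?nnegrE ?cdist_ge0 //.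
apply: le_trans (pole_dist_gap hz); rewrite lerDl mulr_ge0 //; exact: sqr_ge0.
Qed.

(** Here $z$ is within $(2+2\rho)\lambda$ of the nearer pole, so the gap $3\lambda^2$ is a fixed
    fraction of the squared distance. The lower bound thus does not depend on $\lambda$. *)
Lemma dipole_near z t : cdist zeta z < rho -> 0 < lam -> `|t - c| <= lam ->
  cdist z (circ zeta rho t) <= lam ->
  2^-1 * ln (1 + 3 / (2 + 2 * rho) ^+ 2) <= dipole zeta rho lam c z.
Proof.
move=> hz l0 tc zt; have r0 := rho0.
have d1 : 0 < cdist z (circ zeta (rho + lam) c) by apply: pole_dist_gt0; rewrite // lerDl ?mulr_ge0.
have d2 : 0 < cdist z (circ zeta (rho + 2 * lam) c) by apply: pole_dist_gt0; rewrite // lerDl ?mulr_ge0.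
have gap := pole_dist_gap hz.
have hk : cdist z (circ zeta (rho + lam) c) <= (2 + 2 * rho) * lam.
  have h1 := cdist_triangle z (circ zeta rho t) (circ zeta (rho + lam) c).
  have h2 := cdist_triangle (circ zeta rho t) (circ zeta rho c) (circ zeta (rho + lam) c).
  have h3 := circ_lip zeta t c (ltW rho0).
  have h4 : cdist (circ zeta rho c) (circ zeta (rho + lam) c) = lam.
    by rewrite circ_radial ?lerDl // addrC addKr.
  have h5 : rho * `|t - c| <= rho * lam by rewrite ler_pM2l.
  have : cdist z (circ zeta (rho + lam) c) <= lam + (2 * (rho * lam) + lam).
    apply: (le_trans h1); apply: lerD => //; apply: (le_trans h2); rewrite h4 lerD2r.
    by apply: (le_trans h3); rewrite ler_pM2l.
  by rewrite (_ : (2 + 2 * rho) * lam = lam + (2 * (rho * lam) + lam)) //; ring.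
rewrite /dipole; set x := cdist z _ in d1 gap hk *; set y := cdist z _ in d2 gap *.
have k0 : 0 < (2 + 2 * rho) ^+ 2 by rewrite exprn_gt0 //; lra.
have l1 : ln ((1 + 3 / (2 + 2 * rho) ^+ 2) * x ^+ 2) <= ln (y ^+ 2).
  rewrite ler_ln ?posrE ?exprn_gt0 ?mulr_gt0 ?exprn_gt0 //; last first.
    by rewrite ltr_pwDl // divr_ge0 // ltW.
  apply: le_trans gap; rewrite mulrDl mul1r lerD2l -mulrA ler_pM2l // mulrC.
  rewrite ler_pdivrMr // -exprMn ler_pXn2r ?nnegrE ?(ltW d1) ?mulr_ge0 //; lra.
rewrite lnM ?posrE ?exprn_gt0 // in l1; last by rewrite ltr_pwDl // divr_ge0 // ltW.
rewrite !lnXn // !mulr2n in l1.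
lra.
Qed.

Lemma dipole_far z : cdist zeta z < rho / 2 ->
  dipole zeta rho lam c z <= 2 * lam / rho.
Proof.
have r0 := rho0; have l0 := lam0; move=> hz; have hz' : cdist zeta z < rho by lra.
have d1 : 0 < cdist z (circ zeta (rho + lam) c) by apply: pole_dist_gt0; rewrite // lerDl ?mulr_ge0.
have d2 : 0 < cdist z (circ zeta (rho + 2 * lam) c) by apply: pole_dist_gt0; rewrite // lerDl ?mulr_ge0.
have hx : rho / 2 <= cdist z (circ zeta (rho + lam) c).
  by have := @pole_dist_ge z (rho + lam) (addr_ge0 (ltW rho0) lam0); lra.
have hy : cdist z (circ zeta (rho + 2 * lam) c) <= cdist z (circ zeta (rho + lam) c) + lam.
  have := cdist_triangle z (circ zeta (rho + lam) c) (circ zeta (rho + 2 * lam) c).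
  by rewrite circ_radial; lra.
rewrite /dipole; set x := cdist z _ in d1 hx hy *; set y := cdist z _ in d2 hy *.
rewrite -ln_div ?posrE //; apply: (@le_trans _ _ (y / x - 1)).
  by rewrite -[X in ln X](subrKC 1) le_ln1Dx // ltrBrDl subrr divr_gt0.
rewrite (_ : y / x - 1 = (y - x) / x); last by field; rewrite gt_eqF.
rewrite ler_pdivrMr //.
rewrite (_ : 2 * lam / rho * x = lam * (2 * x / rho)); last by field; rewrite gt_eqF.
have : 1 <= 2 * x / rho by rewrite ler_pdivlMr //; lra.
nra.
Qed.

End DipoleFacts.
End Dipole.

(** * From a local barrier to a competitor on the whole domain *)

Section Bouligand.
Variable R : realType.
Notation C := (R * R)%type.
Implicit Types (z w zeta : C) (D S : set C).

Lemma circle_param zeta w : exists t : R,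
  0 <= t <= 2 * pi /\ w = circ zeta (cdist zeta w) t.
Proof.
have [t [t0 t1 h1 h2]] := polar_coord (w.1 - zeta.1) (w.2 - zeta.2).
exists t; split; first by rewrite t0.
have E : Num.sqrt ((w.1 - zeta.1) ^+ 2 + (w.2 - zeta.2) ^+ 2) = cdist zeta w by rewrite cdistC.
rewrite E in h1 h2; rewrite /circ -h1 -h2 !(addrC zeta.1) !(addrC zeta.2) !subrK.
exact: surjective_pairing.
Qed.

Definition circle_level D (u : C -> \bar R) zeta (rho : R) (n : nat) : set (measurableTypeR R) :=
  [set t : R | 0 <= t <= 2 * pi /\ D (circ zeta rho t) /\
     (- (n.+1%:R^-1)%:E <= u (circ zeta rho t))%E].

(** The barrier is strictly negative, so these sets decrease to the empty set and their measures
    tend to $0$. *)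
Lemma circle_level_small D N (u : C -> \bar R) zeta (rho l : R) :
  open D -> open N -> subharmonic (D `&` N) u ->
  (forall w, cdist zeta w <= rho -> N w) -> 0 <= rho ->
  (forall z, D z -> N z -> (u z < 0)%E) -> 0 < l ->
  exists n : nat, (lebesgue_measure (circle_level D u zeta rho n) < l%:E)%E.
Proof.
move=> oD oN su hN rho0 u0 l0.
pose L n := circle_level D u zeta rho n.
have Nt t : N (circ zeta rho t) by apply: hN; rewrite circE_dist.
pose OD : set R := circ zeta rho @^-1` D.
pose OB n : set R := [set t | D (circ zeta rho t) /\ (u (circ zeta rho t) < - (n.+1%:R^-1)%:E)%E].
have oOD : open OD.
  by apply: open_comp => // t _; exact: circ_continuous.
have oOB n : open (OB n).
  rewrite openE => t [Dt ut].
  have [_ us _] := su.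
  have h1 : \forall w \near circ zeta rho t, (u w < - (n.+1%:R^-1)%:E)%E.
    by apply: us => //; split.
  have h2 : \forall w \near circ zeta rho t, D w by exact: open_nbhs_nbhs.
  have h := @circ_continuous R zeta rho t _ (filterI h2 h1).
  exact: h.
have mL n : measurable (L n).
  rewrite (_ : L n = `[0, 2 * pi]%classic `&` (OD `&` ~` OB n)).
    apply: measurableI; first exact: measurable_itv.
    apply: measurableI; first exact: open_measurable.
    by apply: measurableC; exact: open_measurable.
  apply/seteqP; split => t; rewrite /L /circle_level /OD /OB /= in_itv /=.
    by move=> [h1 [h2 h3]]; split => //; split => // -[_]; rewrite ltNge h3.
  move=> [h1 [h2 h3]]; split => //; split => //; rewrite leNgt; apply/negP => h4.
  by apply: h3; split.
have Lcap : \bigcap_n L n = set0.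
  apply/seteqP; split => t // ht.
  have [_ [Dt _]] := ht 0%N I; have := u0 _ Dt (Nt t).
  case E : (u (circ zeta rho t)) => [x| |] //; last first.
    by have [_ [_]] := ht 0%N I; rewrite E leeNy_eq.
  rewrite lte_fin => x0.
  have [_ [_]] := ht (Num.trunc (- x)^-1) I; rewrite E -EFinN lee_fin lerNl => h.
  have y0 : 0 < - x by rewrite oppr_gt0.
  have := truncnS_gt (- x)^-1; rewrite ltNge => /negP; apply.
  by rewrite -[X in X <= _]invrK lef_pV2 ?posrE ?invr_gt0.
have cv : (lebesgue_measure \o L) n @[n --> \oo] --> lebesgue_measure (\bigcap_n L n).
  apply: nonincreasing_cvg_mu => //.
  - apply: (@le_lt_trans _ _ (lebesgue_measure (`[0%R, (2 * pi)%R]%classic : set (measurableTypeR R)))).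
      apply: le_measure; rewrite ?inE; [exact: mL|exact: measurable_itv|].
      by move=> t [h _]; rewrite /= in_itv.
    by rewrite measure_circ_itv ltry.
  - by rewrite Lcap; exact: measurable0.
  - move=> n k nk; apply/subsetPset => t [h1 [h2 h3]]; split => //; split => //.
    apply: le_trans h3; rewrite -!EFinN lee_fin lerN2.
    by rewrite lef_pV2 ?posrE // ler_nat ltnS.
rewrite Lcap measure0 in cv.
have [n _ hn] : \forall n \near \oo, ((lebesgue_measure \o L) n < l%:E)%E.
  have l0' : (0 < l%:E)%E by rewrite lte_fin.
  have nb : nbhs (0%E : \bar R) [set y | (y < l%:E)%E].
    by apply: open_nbhs_nbhs; split => //; exact: open_ereal_lt_ereal.
  exact: (cv _ nb).
by exists n; exact: (hn n (leqnn n)).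
Qed.

(* Bouligand's lemma.  On the circle of radius [rho], the set where the barrier
   is [>= -1/(n+1)] is covered by short arcs, on which the sum of dipoles exceeds
   the threshold [c0] while staying small near the centre. *)
Lemma bouligand D S zeta (eps : R) :
  open D -> regular_point D zeta -> closed S -> ~ S zeta -> 0 < eps ->
  exists (v : C -> \bar R) (delta : R),
    [/\ 0 < delta, subharmonic D v,
      (forall z, D z -> (v z <= 0)%E),
      (forall z, D z -> S z -> (v z <= (-1)%:E)%E) &
      (forall z, D z -> cdist zeta z < delta -> ((- eps)%:E <= v z)%E)].
Proof.
move=> oD [N [u [oN Nz su u0 hu]]] cS Sz eps0.
have /openCP /(_ zeta Nz) [e1 e10 hN] := oN.
have [e2 e20 hS] := closed_far cS Sz.
pose rho := Num.min e1 e2 / 2.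
have rho0 : 0 < rho by rewrite divr_gt0 // lt_min e10.
have re1 : rho < e1.
  have : Num.min e1 e2 <= e1 by rewrite ge_min lexx.
  by rewrite /rho; lra.
have re2 : rho < e2.
  have : Num.min e1 e2 <= e2 by rewrite ge_min lexx orbT.
  by rewrite /rho; lra.
have hNr w : cdist zeta w <= rho -> N w by move=> h; apply: hN; exact: le_lt_trans re1.
pose c0 : R := 2^-1 * ln (1 + 3 / (2 + 2 * rho) ^+ 2).
have k0 : 0 < (2 + 2 * rho) ^+ 2 by rewrite exprn_gt0 //; lra.
have c00 : 0 < c0 by rewrite mulr_gt0 // ln_gt0 // ltrDl divr_gt0.
(* Chosen so that $c_0^{-1}\cdot(2/\rho)\cdot l=\varepsilon/2$: the dipoles then cost at most
   $\varepsilon/2$ near $\zeta$. *)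
pose l : R := eps * c0 * rho / 4.
have l0 : 0 < l by exact: divr_gt0 (mulr_gt0 (mulr_gt0 eps0 c00) rho0) (@ltr0n R 4).
have [n hn] := circle_level_small oD oN su hNr (ltW rho0) u0 l0.
have [c [lam [lam0 hcov hsum]]] := lebesgue_cover hn.
have n0 : 0 < n.+1%:R :> R by [].
have ic0 : 0 < c0^-1 by rewrite invr_gt0.
pose Delta : set C := [set z | cdist zeta z < rho].
have oDelta : open Delta.
  apply/openCP => z /= hz; exists (rho - cdist zeta z); first by rewrite subr_gt0.
  by move=> w hw; rewrite /Delta /= (le_lt_trans (cdist_triangle _ z _)) // -ltrBrDl.
pose g k := dipole zeta rho (lam k) (c k).
have hg k : mean_harmonic Delta (g k) by exact: dipole_harmonic.
have g0 k z : Delta z -> 0 <= g k z by move=> hz; exact: dipole_ge0.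
pose G z : \bar R := (\sum_(0 <= k <oo) (g k z)%:E)%E.
have G0 z : Delta z -> (0 <= G z)%E.
  by move=> hz; apply: nneseries_ge0 => k _ _; rewrite lee_fin g0.
(* Near the circle one of the two terms is $\le-1$: the multiple of the barrier off the level set,
   the dipoles near the covering arcs. Hence [v0] is $\le-1$ there and the gluing with $-1$ is
   seamless. *)
pose v0 z : \bar R := (n.+1%:R%:E * u z + c0^-1%:E * - G z)%E.
pose v z : \bar R := if cdist zeta z < rho then maxe (v0 z) (-1)%:E else (-1)%:E.
have oDD : open (D `&` Delta) by exact: openI.
have sv0 : subharmonic (D `&` Delta) v0.
  apply: subharmonic_add; apply: subharmonic_scale => //.
    by apply: (subharmonic_sub _ _ su) => // z [Dz hz]; split => //; apply: hNr; exact: ltW.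
  apply: (@subharmonic_sub _ Delta) => //.
  exact: subharmonic_nneseries.
have un0 z : D z -> Delta z -> (n.+1%:R%:E * u z <= 0)%E.
  move=> Dz hz; apply: mule_ge0_le0; first by rewrite lee_fin.
  by apply: ltW; apply: u0 => //; apply: hNr; exact: ltW.
have Gn0 z : Delta z -> (c0^-1%:E * - G z <= 0)%E.
  move=> hz; apply: mule_ge0_le0; first by rewrite lee_fin ltW.
  by rewrite leeNl oppe0 G0.
have v0_le0 z : D z -> Delta z -> (v0 z <= 0)%E.
  by move=> Dz hz; rewrite -[X in (_ <= X)%E]adde0; apply: leeD; [exact: un0|exact: Gn0].
have vconst z : D z -> ~ Delta z -> exists2 e : R, 0 < e &
    forall w, cdist z w < e -> D w /\ v w = (-1)%:E.
  move=> Dz /negP; rewrite -leNgt => hz.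
  have /openCP /(_ z Dz) [e e0 hD] := oD.
  suff [e' e'0 he'] : exists2 e' : R, 0 < e' &
      forall w, D w -> cdist z w < e' -> Delta w -> (v0 w <= (-1)%:E)%E.
    exists (Num.min e e'); first by rewrite lt_min e0.
    move=> w; rewrite lt_min => /andP[h1 h2]; split; first exact: hD.
    by rewrite /v; case: ifP => // hw; apply/max_idPr; apply: he' => //; exact: hD.
  move: hz; rewrite le_eqVlt => /predU1P[hz|hz]; last first.
    exists (cdist zeta z - rho); first by rewrite subr_gt0.
    move=> w _ h1 h2; exfalso; rewrite /Delta /= in h2.
    by have := cdist_triangle zeta w z; rewrite (cdistC w z); lra.
  have [t [ht zt]] := circle_param zeta z; rewrite -hz in zt.
  (* If the barrier is high at the circle point, its angle lies in a covering interval and that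
     dipole alone reaches [c0]. Otherwise the barrier stays below $-1/(n+1)$ nearby by upper
     semicontinuity. *)
  have [hb|hb] := leP (- (n.+1%:R^-1)%:E)%E (u z).
    have [|k [lk tk]] := hcov t; first by split => //; rewrite -zt.
    exists (lam k) => // w Dw h1 h2.
    rewrite -[X in (_ <= X)%E]add0e; apply: leeD; first exact: un0.
    have hG : (c0%:E <= G w)%E.
      apply: (@le_trans _ _ (g k w)%:E).
        rewrite lee_fin; apply: (dipole_near rho0 (lam0 k) h2 lk tk).
        by rewrite -zt cdistC ltW.
      have := @nneseries_lim_ge R (fun k => (g k w)%:E) xpredT 0 k.+1.
      move=> /(_ (fun _ _ _ => _)) h; apply: le_trans (h _); last by move=> *; rewrite lee_fin g0.
      rewrite big_nat_recr //= leeDr // sume_ge0 // => i _; by rewrite lee_fin g0.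
    rewrite muleN leeNl EFinN oppeK -[X in (X <= _)%E](_ : (c0^-1%:E * c0%:E = 1)%E).
      by rewrite lee_pmul2l // lte_fin.
    by rewrite -EFinM mulVf // gt_eqF.
  have [_ us _] := su.
  have Nzz : N z by apply: hNr; rewrite -hz.
  have := us z (conj Dz Nzz) (- n.+1%:R^-1); rewrite EFinN => /(_ hb).
  move=> /near_cdistP [e' e'0 he']; exists e' => // w Dw h1 h2.
  rewrite -[X in (_ <= X)%E]adde0; apply: leeD; last exact: Gn0.
  have := he' w h1; move: (u w) => [x| |] // hx.
    rewrite -EFinM lee_fin; move: hx; rewrite lte_fin => hx.
    rewrite -(@ler_pM2l _ (n.+1%:R^-1)) ?invr_gt0 // mulrA mulVf ?gt_eqF // mul1r mulrN1.
    exact: ltW.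
  by rewrite gt0_muleNy // leNye.
have hD0 (z : C) : D z -> Delta z -> (-1)%:E = (-1)%:E :> \bar R by [].
have [delta1 d10 hd1] := hu (eps / 2 / n.+1%:R) (divr_gt0 (divr_gt0 eps0 (@ltr0n R 2)) n0).
exists v, (Num.min delta1 (rho / 2)); split.
- by rewrite lt_min d10 divr_gt0.
- apply: subharmonic_local => z Dz.
  have [hz|hz] := pselect (Delta z).
    exists (D `&` Delta); split => //.
    apply: (@subharmonic_ext _ _ (fun z => maxe (v0 z) (-1)%:E)).
      by move=> w [_ hw]; rewrite /v hw.
    by apply: subharmonic_max => //; exact: subharmonic_cst.
  have [e e0 he] := vconst z Dz hz; exists [set w | cdist z w < e]; split.
  + by rewrite /= cdist0.
  + by move=> w /he [].
  + apply: (@subharmonic_ext _ _ (fun=> (-1)%:E)); first by move=> w /he [].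
    apply: subharmonic_cst; apply/openCP => w /= hw.
    exists (e - cdist z w); first by rewrite subr_gt0.
    by move=> w' hw'; rewrite (le_lt_trans (cdist_triangle _ w _)) // -ltrBrDl.
- move=> z Dz; rewrite /v; case: ifP => hz; last by rewrite lee_fin; lra.
  by rewrite ge_max v0_le0 //= lee_fin; lra.
- move=> z Dz Sz'; rewrite /v; case: ifP => // hz.
  by have := hS z Sz'; rewrite leNgt (lt_trans hz).
- move=> z Dz; rewrite lt_min => /andP[h1 h2].
  have hz : cdist zeta z < rho by lra.
  rewrite /v hz le_max; apply/orP; left.
  have -> : (- eps)%:E = ((- (eps / 2))%:E + (- (eps / 2))%:E)%E.
    by rewrite -EFinD; congr EFin; field.
  apply: leeD.
    have := hd1 z Dz (hNr z (ltW hz)); rewrite cdistC => /(_ h1).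
    have := u0 z Dz (hNr z (ltW hz)); move: (u z) => [x| |] // _.
    rewrite lte_fin -EFinM lee_fin => hx.
    rewrite -(@ler_pM2l _ (n.+1%:R^-1)) ?invr_gt0 // mulrA mulVf ?gt_eqF // mul1r.
    by rewrite mulrN mulrC ltW.
  have hG : (G z <= (2 / rho)%:E * (\sum_(0 <= k <oo) (lam k)%:E))%E.
    rewrite -nneseriesZl; last by move=> k _; rewrite lee_fin.
    apply: lee_nneseries => k _; first by move=> _; rewrite lee_fin g0.
    rewrite -EFinM lee_fin mulrAC; exact: dipole_far.
  rewrite muleN leeNr -EFinN opprK.
  apply: (@le_trans _ _ (c0^-1%:E * ((2 / rho)%:E * l%:E))%E).
    rewrite lee_pmul2l //; apply: (le_trans hG); rewrite lee_pmul2l //; last first.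
      by rewrite lte_fin divr_gt0.
    exact: ltW.
  rewrite -!EFinM lee_fin /l.
  by rewrite (_ : c0^-1 * _ = eps / 2) //; field; rewrite !gt_eqF.
Qed.

End Bouligand.

(** * Competitors, their continuation across $K$, and the conclusion *)

Section Competitors.
Variable R : realType.
Notation C := (R * R)%type.
Implicit Types (z w zeta : C) (D S K : set C) (v : C -> \bar R).

Definition competitor S D v := subharmonic D v /\
  (forall w, D w -> S w -> (v w <= (-1)%:E)%E) /\ (forall w, D w -> (v w <= 0)%E).

Lemma harm_measure_le z S D v : competitor S D v -> (harm_measure z S D <= - v z)%E.
Proof. by move=> hv; rewrite leeN2; apply: ereal_sup_ubound; exists v. Qed.

Lemma harm_measure_ge z S D (x : \bar R) :
  (forall v, competitor S D v -> (x <= - v z)%E) -> (x <= harm_measure z S D)%E.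
Proof.
move=> h; rewrite leeNr; apply: ge_ereal_sup => _ [v hv <-].
by rewrite leeNr; exact: h.
Qed.

Lemma closed_discP (a : C) (r : R) : closed (closed_disc a r).
Proof.
rewrite -[closed_disc a r]setCK; apply: open_closedC; apply/openCP => z /= /negP.
rewrite -ltNge => hz; exists (cdist a z - r); first by rewrite subr_gt0.
move=> w hw /=; apply/negP; rewrite -ltNge.
by have := cdist_triangle a w z; rewrite (cdistC w z); lra.
Qed.

Lemma compact_far K z : compact K -> ~ K z ->
  exists2 e : R, 0 < e & forall w, K w -> e <= cdist z w.
Proof.
move=> cK Kz; have [w Kw|e e0 he] := @compact_annulus R K z 0 cK.
  by apply/eqP => /cdist_eq0 wz; apply: Kz; rewrite -wz.
exists e => // w /he; by rewrite subr0 ger0_norm ?cdist_ge0 // cdistC.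
Qed.

Lemma cdist_bounded D K : compact K ->
  (exists M : R, forall z, D z -> `|z.1| <= M /\ `|z.2| <= M) ->
  exists2 d : R, 0 < d & forall z w, D z -> K w -> cdist z w <= d.
Proof.
move=> cK [M hM]; have [b b0 hb] := compactC_bounded ((0, 0) : C) cK.
exists (2 * `|M| + b); first by rewrite ltr_wpDl.
move=> z w /hM [h1 h2] /hb hw; apply: (le_trans (cdist_triangle _ (0, 0) _)).
apply: lerD; last by rewrite cdistC ltW.
by apply: cdist_le; rewrite //= subr0 (le_trans _ (ler_norm M)).
Qed.

Lemma open_prod_lt (s : seq C) (c : R) : open [set w : C | \prod_(q <- s) cdist w q < c].
Proof.
have cf : continuous (fun w : C => \prod_(q <- s) cdist w q).
  elim: s => [|q s IH] w.
    by rewrite (_ : (fun _ => _) = (fun=> 1)); [exact: cvg_cst|apply/funext => x; rewrite big_nil].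
  rewrite (_ : (fun w => _) = (fun w => cdist w q * \prod_(q <- s) cdist w q)).
    by apply: cvgM; [exact: cdist_continuous|exact: IH].
  by apply/funext => x; rewrite big_cons.
apply: (@open_comp _ _ (fun w : C => \prod_(q <- s) cdist w q) [set x | x < c]).
  by move=> w _; exact: cf.
exact: open_lt.
Qed.

(* Near [K] the added potential [h] is below [-1], so that the competitor can be
   continued across [K] by the constant [-1]. *)
Lemma extend_competitor D S K v (eps c0 : R) :
  bounded_domain D -> S `<=` D -> compact K -> K !=set0 -> polar K ->
  K `<=` boundary D -> competitor S D v -> 0 < eps -> 0 < c0 ->
  exists (U : set C) (v' : C -> \bar R), [/\ open U /\ K `<=` U,
    (forall w, U w -> exists2 k, K k & cdist w k < c0),
    competitor S (D `|` U) v' &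
    forall w, D w -> (forall k, K k -> c0 <= cdist w k) -> (v w - eps%:E <= v' w)%E].
Proof.
move=> [oD _ _ bD] SD cK K0 pK KD [sv [vS v0]] eps0 c00.
have [d d0 hd] := cdist_bounded cK bD.
(* A positive bound for $\log(d/c_0)$. With [del] $=\varepsilon/\kappa$, the added potential lowers
   $v$ by at most $\varepsilon$ at points at distance $\ge c_0$ from $K$. *)
pose kap : R := Num.max 0 (ln d - ln c0) + 1.
have kap0 : 0 < kap by rewrite ltr_wpDl // le_max lexx.
have kapd : ln d - ln c0 <= kap.
  have : ln d - ln c0 <= Num.max 0 (ln d - ln c0) by rewrite le_max lexx orbT.
  by rewrite /kap; lra.
pose del := eps / kap; have del0 : 0 < del by exact: divr_gt0.
(* This $M$ makes the normalised potential at most $-\delta M-\delta\log d=-1$ wherever the product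
   is below $e^{-Mn}$. *)
have [s [s0 Ks hs]] := polar_poly (del^-1 - ln d) cK K0 pK.
have n0 : 0 < (size s)%:R :> R by rewrite ltr0n lt0n size_eq0.
set n : R := (size s)%:R in hs n0.
have DK w : D w -> ~ K w by move=> Dw /KD [].
have ds0 w q : D w -> q \in s -> 0 < cdist w q.
  by move=> Dw qs; apply: cdist_gt0 => wq; apply: (DK w Dw); rewrite wq; exact: Ks.
pose h0 w := (del / n) * \sum_(q <- s) ln (cdist w q).
have lnE w : D w -> \sum_(q <- s) ln (cdist w q) = ln (\prod_(q <- s) cdist w q).
  move=> Dw; have : forall q, q \in s -> 0 < cdist w q by move=> q; exact: ds0.
  elim: s {s0 Ks hs n0 ds0 n h0} => [|q s IH] hq; first by rewrite !big_nil ln1.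
  have hq' q' : q' \in s -> 0 < cdist w q' by move=> q's; apply: hq; rewrite inE q's orbT.
  rewrite !big_cons lnM ?posrE ?IH ?hq ?mem_head //.
  by rewrite big_seq; apply: prodr_gt0 => q' /hq'.
have mh0 : mean_harmonic D h0.
  have hsum : mean_harmonic D (fun w => \sum_(q <- s) ln (cdist w q)).
    apply: mean_harmonic_sum => q qs; apply: mean_harmonic_ln => /DK; apply; exact: Ks.
  rewrite (_ : h0 = fun w => (del / n) * \sum_(q <- s) ln (cdist w q) + 0 * 0).
    by apply: mean_harmonic_lin => //; exact: mean_harmonic0.
  by apply/funext => w; rewrite mulr0 addr0.
pose v1 w : \bar R := maxe ((v w + (h0 w)%:E) + (- (del * ln d))%:E)%E (-1)%:E.
have sv1 : subharmonic D v1.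
  apply: subharmonic_max; last exact: subharmonic_cst.
  apply: subharmonic_add; last exact: subharmonic_cst.
  by apply: subharmonic_add => //; exact: mean_harmonic_subharmonic.
pose U : set C := [set w | \prod_(q <- s) cdist w q < expR (- (del^-1 - ln d) * n)] `&`
  [set w | exists2 k, K k & cdist w k < c0].
have oU : open U.
  apply: openI; first exact: open_prod_lt.
  apply/openCP => w [k Kk wk]; exists (c0 - cdist w k); first by rewrite subr_gt0.
  move=> w' hw'; exists k => //; rewrite (le_lt_trans (cdist_triangle _ w _)) //.
  by rewrite (cdistC w' w) -ltrBrDr.
have KU : K `<=` U.
  by move=> k Kk; split; [exact: hs|exists k; rewrite ?cdist0].
have h0_le0 w : D w -> h0 w - del * ln d <= 0.
  move=> Dw; rewrite subr_le0 /h0 -mulrA ler_pM2l // mulrC ler_pdivrMr //.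
  have : \sum_(q <- s) ln (cdist w q) <= \sum_(q <- s) ln d.
    rewrite big_seq [leRHS]big_seq; apply: ler_sum => q qs.
    by rewrite ler_ln ?posrE ?ds0 //; apply: hd => //; exact: Ks.
  by rewrite big_const_seq count_predT iter_addr_0 -[ln d *+ _]mulr_natr.
have v1U w : D w -> U w -> v1 w = (-1)%:E.
  move=> Dw [hw _]; apply/max_idPr.
  have hh : h0 w - del * ln d <= -1.
    have : \sum_(q <- s) ln (cdist w q) <= - (del^-1 - ln d) * n.
      rewrite lnE // -[leRHS]expRK ler_ln ?posrE ?expR_gt0 ?(ltW hw) //.
      by rewrite big_seq; apply: prodr_gt0 => q; exact: ds0.
    move=> hsum; have : (del / n) * \sum_(q <- s) ln (cdist w q) <=
        (del / n) * (- (del^-1 - ln d) * n) by rewrite ler_pM2l // divr_gt0.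
    rewrite (_ : (del / n) * (- (del^-1 - ln d) * n) = -1 + del * ln d); last first.
      by field; rewrite !gt_eqF.
    by rewrite /h0; lra.
  rewrite -addeA -EFinD; apply: (@le_trans _ _ (0 + (-1)%:E)%E); last by rewrite add0e.
  by apply: leeD; [exact: v0|rewrite lee_fin].
pose v' w : \bar R := if `[< D w >] then v1 w else (-1)%:E.
have v'D w : D w -> v' w = v1 w by move=> Dw; rewrite /v' asboolT.
have v'U w : U w -> v' w = (-1)%:E.
  by move=> Uw; rewrite /v'; case: asboolP => // Dw; exact: v1U.
exists U, v'; split => //.
- by move=> w [].
- split; last split.
  + apply: subharmonic_setU.
      by apply: subharmonic_ext sv1 => w Dw; rewrite v'D.
    apply: (@subharmonic_ext _ _ (fun=> (-1)%:E)); first by move=> w Uw; rewrite v'U.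
    exact: subharmonic_cst.
  + move=> w _ Sw; have Dw := SD w Sw; rewrite v'D // ge_max lexx andbT.
    rewrite -addeA -EFinD -[leRHS]adde0; apply: leeD; first exact: vS.
    by rewrite lee_fin h0_le0.
  + move=> w [Dw|Uw]; last by rewrite v'U // lee_fin; lra.
    rewrite v'D // ge_max; apply/andP; split; last by rewrite lee_fin; lra.
    rewrite -addeA -EFinD -[leRHS]adde0; apply: leeD; first exact: v0.
    by rewrite lee_fin h0_le0.
- move=> w Dw hw; rewrite v'D // le_max; apply/orP; left.
  rewrite -addeA -EFinD; apply: leeD => //; rewrite -EFinN lee_fin.
  have hsum : \sum_(q <- s) ln c0 <= \sum_(q <- s) ln (cdist w q).
    rewrite big_seq [leRHS]big_seq; apply: ler_sum => q qs.
    by rewrite ler_ln ?posrE ?ds0 //; apply: hw; exact: Ks.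
  rewrite big_const_seq count_predT iter_addr_0 -[ln c0 *+ _]mulr_natr -/n in hsum.
  have hm : (del / n) * (ln c0 * n) <= h0 w by rewrite ler_pM2l // divr_gt0.
  rewrite (_ : (del / n) * (ln c0 * n) = del * ln c0) in hm; last by field; rewrite gt_eqF.
  have : del * (ln d - ln c0) <= del * kap by rewrite ler_pM2l.
  rewrite (_ : del * kap = eps); last by rewrite /del divfK // gt_eqF.
  by rewrite mulrBr; lra.
Qed.

(* A circle about [zeta] missing [K] lets one replace [v'] inside it by
   [max v' (-eps)], which is [>= -eps] at [zeta] itself. *)
Lemma competitor_at_regular D S K zeta (eps : R) :
  bounded_domain D -> S `<=` D -> closed S -> compact K -> polar K ->
  K `<=` boundary D -> K zeta -> regular_point D zeta -> 0 < eps ->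
  exists (U : set C) (v : C -> \bar R), [/\ open U, K `<=` U,
    competitor S (D `|` U) v & ((- eps)%:E <= v zeta)%E].
Proof.
move=> bD SD cS cK pK KD Kz rz eps0.
have [oD _ _ _] := bD.
have Dz : ~ D zeta by have [] := KD _ Kz.
have Sz : ~ S zeta by move=> /SD.
have e2 : 0 < eps / 2 by rewrite divr_gt0.
have [v [delta [d0 sv v0 vS hv]]] := bouligand oD rz cS Sz e2.
have [e e0 he] := closed_far cS Sz.
have polK (M : R) : exists s : seq C, s != [::] /\
     forall w, K w -> \prod_(q <- s) cdist w q < expR (- M * (size s)%:R).
  by have [s [s0 _ hs]] := polar_poly M cK (ex_intro _ _ Kz) pK; exists s.
have [tau [tau0]] := @polar_radius R K zeta (Num.min delta e) polK
  (ltac:(by rewrite lt_min d0)).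
rewrite lt_min => -[/andP[taud taue] hK].
have [d1 d10 hd1] := compact_annulus cK hK.
(* The first bound keeps the annulus of half-width [c0] about the circle at distance $\ge c_0$ from
   $K$; the second keeps it inside the disc where [v] is at least $-\varepsilon/2$. *)
pose c0 := Num.min (d1 / 2) (delta - tau).
have c00 : 0 < c0 by rewrite lt_min divr_gt0 // subr_gt0.
have c0d1 : c0 <= d1 / 2 by rewrite ge_min lexx.
have c0del : c0 <= delta - tau by rewrite ge_min lexx orbT.
have [U [v' [[oU KU] nU [sv' [vS' v'0]] hv']]] :=
  extend_competitor bD SD cK (ex_intro _ _ Kz) pK KD (conj sv (conj vS v0)) e2 c00.
have offK w k : `|cdist zeta w - tau| < c0 -> K k -> c0 <= cdist w k.
  move=> hw Kk; rewrite leNgt; apply/negP => wk.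
  have := hd1 k Kk; have := cdist_lip k w zeta.
  rewrite (cdistC w zeta) (cdistC k w) => h1 h2.
  have := ler_distD (cdist zeta w) (cdist k zeta) tau; lra.
(* Points of [U] lie within [c0] of $K$, so on the annulus only points of $D$ remain. There [v] is
   at least $-\varepsilon/2$ and the continuation loses at most another $\varepsilon/2$, so the
   maximum with $-\varepsilon$ changes nothing near the circle. *)
have ring w : (D `|` U) w -> `|cdist zeta w - tau| < c0 -> ((- eps)%:E <= v' w)%E.
  move=> DUw hw.
  have Dw : D w.
    case: DUw => // /nU [k Kk]; by rewrite ltNge (offK w k).
  have := hv' w Dw (fun k Kk => offK w k hw Kk); apply: le_trans.
  have hwd : cdist zeta w < delta.
    by have := ler_norm (cdist zeta w - tau); lra.
  have := hv w Dw hwd; case: (v w) => [x| |] //=; last by rewrite addye ?leey.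
  by rewrite -EFinB !lee_fin; lra.
pose v'' w : \bar R := if cdist zeta w < tau then maxe (v' w) (- eps)%:E else v' w.
have oDU : open (D `|` U) by exact: openU.
exists U, v''; split => //; last first.
  by rewrite /v'' cdist0 tau0 le_max lexx orbT.
split; last split.
- apply: subharmonic_local => w DUw.
  have [wt|wt] := ltP (cdist zeta w) tau.
    exists ((D `|` U) `&` [set w | cdist zeta w < tau]); split => //.
    have oV : open ((D `|` U) `&` [set w | cdist zeta w < tau]).
      apply: openI => //; apply/openCP => z /= hz; exists (tau - cdist zeta z).
        by rewrite subr_gt0.
      by move=> x hx; rewrite (le_lt_trans (cdist_triangle _ z _)) // -ltrBrDl.
    apply: (@subharmonic_ext _ _ (fun w => maxe (v' w) (- eps)%:E)).
      by move=> x [_ /= hx]; rewrite /v'' hx.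
    by apply: subharmonic_max; [exact: subharmonic_sub sv'|exact: subharmonic_cst].
  exists ((D `|` U) `&` [set w | tau - c0 < cdist zeta w]); split => //.
    by split => //=; lra.
  have oV : open ((D `|` U) `&` [set w | tau - c0 < cdist zeta w]).
    apply: openI => //; apply/openCP => z /= hz; exists (cdist zeta z - (tau - c0)).
      by rewrite subr_gt0.
    by move=> x hx; have := cdist_triangle zeta x z; rewrite (cdistC x z); lra.
  apply: (@subharmonic_ext _ _ v'); last exact: subharmonic_sub sv'.
  move=> x [DUx /= hx]; rewrite /v''; case: ifP => // xt; apply/esym/max_idPl.
  by apply: ring => //; rewrite ltr_norml; apply/andP; split; lra.
- move=> w DUw Sw; rewrite /v'' ifF; first exact: vS'.
  by apply/negbTE; rewrite -leNgt ltW // (lt_le_trans taue) // he.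
- move=> w DUw; rewrite /v''; case: ifP => _; last exact: v'0.
  by rewrite ge_max v'0 //= lee_fin oppr_le0 ltW.
Qed.

End Competitors.


Theorem theorem3p7 (R : realType) (D : set (R * R)) (a : R * R) (r : R)
    (K : set (R * R)) :
  bounded_domain D -> 0 < r -> closed_disc a r `<=` D ->
  compact K -> K `<=` boundary D -> polar K ->
  (forall z, D z ->
     harm_measure z (closed_disc a r) D =
     ereal_inf [set harm_measure z (closed_disc a r) (D `|` U) |
                U in [set U | open U /\ K `<=` U]]) /\
  (forall z, K z -> regular_point D z ->
     ereal_inf [set harm_measure z (closed_disc a r) (D `|` U) |
                U in [set U | open U /\ K `<=` U]] = 0%E).
Proof.
move=> bD r0 SD cK KD pK; set S := closed_disc a r.
have cS : closed S by exact: closed_discP.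
have mono (z : R * R) (U : set (R * R)) : open D -> (harm_measure z S D <= harm_measure z S (D `|` U))%E.
  move=> oD; apply: harm_measure_ge => v [sv [vS v0]]; apply: harm_measure_le; split.
    by apply: subharmonic_sub sv => //; exact: subsetUl.
  by split=> w Dw; [exact: vS (or_introl Dw)|exact: v0 (or_introl Dw)].
have oD : open D by case: bD.
split=> z; last first.
  move=> Kz rz; apply/eqP; rewrite eq_le; apply/andP; split.
    apply/lee_addgt0Pr => eps eps0; rewrite add0e.
    have [U [v [oU KU cv hv]]] := competitor_at_regular bD SD cS cK pK KD Kz rz eps0.
    apply: (@le_trans _ _ (harm_measure z S (D `|` U))).
      by apply: ereal_inf_lbound; exists U.
    by apply: (le_trans (harm_measure_le z cv)); rewrite leeNl.
  apply: le_ereal_inf_tmp => _ [U [oU KU] <-].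
  apply: harm_measure_ge => v [_ [_ v0]]; rewrite leeNr oppe0.
  by apply: v0; right; exact: KU.
move=> Dz; apply/eqP; rewrite eq_le; apply/andP; split.
  by apply: le_ereal_inf_tmp => _ [U _ <-]; exact: mono.
(* The continuation needs a point of $K$; for empty $K$ the choice $U=\emptyset$ already attains the
   bound. *)
have [K0|K0] : K = set0 \/ K !=set0 by case: (eqVneq K set0) => [|/set0P]; [left|right].
  apply: ereal_inf_lbound; exists set0; last by rewrite setU0.
  by rewrite K0; split => //; exact: open0.
have Kz : ~ K z by move=> /KD [].
have [c0 c00 hc0] := compact_far cK Kz.
apply: harm_measure_ge => v cv.
rewrite leeNr; have := cv.2.2 z Dz.
(* If $v(z)=-\infty$ the bound $-v(z)=+\infty$ is trivial; otherwise the continuation loses at most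
   $\varepsilon$ at $z$, whose distance to $K$ is at least [c0]. *)
case E : (v z) => [x| |] // _; last exact: leNye.
rewrite leeNr -EFinN; apply/lee_addgt0Pr => eps eps0.
have [U [v' [[oU KU] _ cv' hv']]] := extend_competitor bD SD cK K0 pK KD cv eps0 c00.
apply: (@le_trans _ _ (harm_measure z S (D `|` U))).
  by apply: ereal_inf_lbound; exists U.
apply: (le_trans (harm_measure_le z cv')).
have := hv' z Dz hc0; rewrite E leeNl => h; apply: le_trans h.
by rewrite -EFinD -!EFinN -EFinB lee_fin; lra.
Qed.
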